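(* There is an increasing function $f:(0,1)\to(0,1)$ such that for all real numbers $\nu,\tau,\eta$ with $0<\nu\leq\tau\leq f(\eta)$ and $0<\eta<1$ (i.e. $0<\nu\leq\tau\ll\eta<1$), and every positive integer $r$, there is an $n_0$ such that for every $n\geq n_0$ and every robust $(\nu,\tau)$-expander graph $G$ with $n$ vertices and $\delta(G)\geq \eta n$, $$\chi(\mathrm{KG}(G,rK_2))=\zeta(\mathrm{KG}(G,rK_2))=|E(G)|-\mathrm{ex}(G,rK_2).$$
   Context: All graphs and hypergraphs are finite and simple; $\delta(G)$ is the minimum degree and $\chi$ the chromatic number (equal to $0$ for the graph with no vertices). $rK_2$ is a matching of size $r$. Matching graph and Turán number: $\mathrm{KG}(G,rK_2)$ is the graph whose vertices are all matchings of size $r$ in $G$ (subgraphs isomorphic to $rK_2$), two being adjacent if they are edge-disjoint. $\mathrm{ex}(G,rK_2)$ is the maximum number of edges of a spanning subgraph of $G$ containing no subgraph isomorphic to $rK_2$. Robust expanders: for a graph $G$ on $n$ vertices, $0<\nu\le\tau<1$ and $S\subseteq V(G)$, the $\nu$-robust neighborhood $RN_{\nu,G}(S)$ is the set of all vertices $v\in V(G)$ with $|N_G(v)\cap S|\geq \nu n$. $G$ is a robust $(\nu,\tau)$-expander if $|RN_{\nu,G}(S)|\geq |S|+\nu n$ for every $S\subseteq V(G)$ with $\tau n\leq |S|\leq (1-\tau)n$. The notation $a\ll b$ means that there is an increasing function $f$ such that the assertion holds whenever, given $b$, one chooses $a\leq f(b)$. Altermatic number: for $X\in\{-1,0,+1\}^N$,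 $alt(X)$ is the length of a longest subsequence of nonzero terms of $X$ in which any two consecutive terms are different ($alt(0)=0$). For a hypergraph $\mathcal{H}$ (hyperedges are nonempty sets) with $|V(\mathcal{H})|=N$ and a linear ordering $\sigma=(\sigma(1),\ldots,\sigma(N))$ of $V(\mathcal{H})$, put $X^+_\sigma=\{\sigma(j): x_j=+1\}$ and $X^-_\sigma=\{\sigma(j): x_j=-1\}$. $alt_\sigma(\mathcal{H})$ is the largest $k$ for which there is an $X\in\{-1,0,+1\}^N$ with $alt(X)=k$ such that neither $X^+_\sigma$ nor $X^-_\sigma$ contains a hyperedge of $\mathcal{H}$; $alt(\mathcal{H})=\min_\sigma alt_\sigma(\mathcal{H})$. $\mathrm{KG}(\mathcal{H})$ is the graph whose vertices are the hyperedges of $\mathcal{H}$, two being adjacent if they are disjoint. The altermatic number of a graph $F$ is $\zeta(F)=\max_{\mathcal{H}}\{|V(\mathcal{H})|-alt(\mathcal{H})\}$, over all hypergraphs $\mathcal{H}$ such that $\mathrm{KG}(\mathcal{H})$ and $F$ are homomorphically equivalent (there are graph homomorphisms in both directions). *)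

(* Defs.v *)
(* MathComp world; the reals are an arbitrary [realType]. *)
From HB Require Import structures.
From mathcomp Require Import all_boot all_order all_algebra.
From mathcomp Require Import reals.

Set Implicit Arguments.
Unset Strict Implicit.
Unset Printing Implicit Defensive.

Import Order.TTheory GRing.Theory Num.Theory.

Record sgraph := SGraph {
  vertex :> finType;
  adj : rel vertex;
  adj_sym : symmetric adj;
  adj_irr : irreflexive adj }.

Definition neighbors (G : sgraph) (v : G) : {set G} := [set w | adj v w].

(* Degrees are smaller than #|G|, so for a nonempty graph the default value
   #|G| does not affect the minimum. *)
Definition min_degree (G : sgraph) : nat :=
  \big[minn/#|G|]_(v : G) #|neighbors v|.

Definition edges (G : sgraph) : {set {set G}} :=
  [set e : {set G} | [exists x, exists y, adj x y && (e == [set x; y])]].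

Definition colorable (F : sgraph) (k : nat) : bool :=
  [exists c : {ffun F -> 'I_k},
    [forall x, forall y, adj x y ==> (c x != c y)]].

Lemma colorable_card (F : sgraph) : exists k, colorable F k.
Proof.
exists #|F|; apply/existsP; exists [ffun x => enum_rank x].
apply/forallP => x; apply/forallP => y; apply/implyP => xy; rewrite !ffunE.
by apply: contraTneq xy => /enum_rank_inj ->; rewrite adj_irr.
Qed.

Definition chromatic_number (F : sgraph) : nat := ex_minn (colorable_card F).

Definition is_hom (F1 F2 : sgraph) (h : F1 -> F2) : Prop :=
  forall x y : F1, adj x y -> adj (h x) (h y).

Definition hom_equiv (F1 F2 : sgraph) : Prop :=
  (exists h : F1 -> F2, is_hom h) /\ (exists h : F2 -> F1, is_hom h).

(* The graph on a family of sets whose edges are the pairs of distinct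
   disjoint members (distinctness only matters for the empty set). *)
Section Kneser.
Variables (T : finType) (E : {set {set T}}).

Definition kneser_adj : rel {A : {set T} | A \in E} :=
  fun A B => (A != B) && [disjoint val A & val B].

Lemma kneser_adj_sym : symmetric kneser_adj.
Proof. by move=> A B; rewrite /kneser_adj eq_sym disjoint_sym. Qed.

Lemma kneser_adj_irr : irreflexive kneser_adj.
Proof. by move=> A; rewrite /kneser_adj eqxx. Qed.

Definition kneser : sgraph := SGraph kneser_adj_sym kneser_adj_irr.
End Kneser.

(* A copy of r K_2 in G is identified with its set of r pairwise disjoint
   edges. *)
Definition matchings (G : sgraph) (r : nat) : {set {set {set G}}} :=
  [set M : {set {set G}} | [&& M \subset edges G, #|M| == r & trivIset M]].

Definition matching_graph (G : sgraph) (r : nat) : sgraph :=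
  kneser (matchings G r).

(* A spanning subgraph of G is identified with its edge set. *)
Definition turan_matching (G : sgraph) (r : nat) : nat :=
  \max_(E : {set {set G}} | (E \subset edges G) &&
      [forall M in matchings G r, ~~ (M \subset E)]) #|E|.

Record hypergraph := Hypergraph {
  hvertex : finType;
  hedges : {set {set hvertex}};
  hedges_neq0 : set0 \notin hedges }.

(* Sign vectors: None is 0, Some true is +1 and Some false is -1. *)
Definition sign := option bool.

Definition alternating (s : seq sign) : bool :=
  all isSome s && sorted (fun x y => x != y) s.

Definition alt_length (N : nat) (X : N.-tuple sign) : nat :=
  \max_(m : N.-tuple bool | alternating (mask m X)) size (mask m X).

(* The vertices that [s] puts at the positions where X has sign b. *)
Definition sign_part (V : finType) (s : #|V|.-tuple V) (X : #|V|.-tuple sign)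
    (b : bool) : {set V} :=
  [set tnth s j | j : 'I_#|V| & tnth X j == Some b].

(* A linear ordering of the vertices is a duplicate-free tuple of length
   #|V|. *)
Definition alt_ordering (H : hypergraph)
    (s : #|hvertex H|.-tuple (hvertex H)) : nat :=
  \max_(X : #|hvertex H|.-tuple sign |
      [forall e in hedges H, forall b : bool, ~~ (e \subset sign_part s X b)])
    alt_length X.

(* Every [alt_ordering s] is at most the number of vertices, so the default
   value does not affect the minimum. *)
Definition alt_number (H : hypergraph) : nat :=
  \big[minn/#|hvertex H|]_(s : #|hvertex H|.-tuple (hvertex H) | uniq s)
    alt_ordering s.

(* zeta(F) = m, the maximum over all hypergraphs being attained; the
   subtraction is never truncated as [alt_number H <= #|hvertex H|]. *)
Definition is_altermatic_number (F : sgraph) (m : nat) : Prop :=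
  (exists H : hypergraph, hom_equiv (kneser (hedges H)) F /\
     #|hvertex H| - alt_number H = m) /\
  (forall H : hypergraph, hom_equiv (kneser (hedges H)) F ->
     #|hvertex H| - alt_number H <= m).

Local Open Scope ring_scope.

Definition robust_nbhd (R : realType) (nu : R) (G : sgraph) (S : {set G}) :
    {set G} :=
  [set v : G | nu * #|G|%:R <= #|neighbors v :&: S|%:R].

Definition robust_expander (R : realType) (nu tau : R) (G : sgraph) : Prop :=
  forall S : {set G},
    tau * #|G|%:R <= #|S|%:R -> #|S|%:R <= (1 - tau) * #|G|%:R ->
    #|S|%:R + nu * #|G|%:R <= #|robust_nbhd nu S|%:R.

(* Main.v *)
Require Import Defs.
From HB Require Import structures.
From mathcomp Require Import all_boot all_order all_algebra.
From mathcomp Require Import fingroup perm.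
From mathcomp Require Import reals.
From mathcomp Require Import zify.

Set Implicit Arguments.
Unset Strict Implicit.
Unset Printing Implicit Defensive.

Import Order.TTheory GRing.Theory Num.Theory.
Local Open Scope nat_scope.

(** Write KG for the matching graph and E for the edge set of G.  Colouring a
    matching by one of its edges outside a fixed extremal edge set without
    r disjoint edges gives chi(KG) <= |E| - ex.  In the other direction, every
    hypergraph H satisfies |V(H)| <= alt(H) + chi(KG(H))
    ([alt_number_chromatic]); this follows from the octahedral Tucker lemma
    ([octahedral_tucker]).  So both equalities follow once the edges of G are
    ordered in such a way that every alternating sequence of signs, neither
    of whose sign classes contains r disjoint edges, has length at most ex
    ([good_ordering]).

    Such an ordering exists as soon as the minimum degree is linear in the
    number of vertices and large in terms of r.  Let P be an edge set without
    r disjoint edges.  Fewer than r vertices are heavy, i.e. have degree at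
    least 2r in P, and all but 4r^2 edges of P meet a heavy vertex
    ([card_heavy], [card_light]).  Conversely the edges of G meeting a set
    of fewer than r vertices contain no r disjoint edges, so there are at
    most ex of them ([star_turan]).  Let T+ and T- be the sets of heavy vertices
    of the positive and of the negative class.

    - If T+ = T- has r - 1 elements, then all edges that carry a sign meet it,
      so there are at most ex of them.  If T+ = T- is smaller, then all but 8r^2
      of these edges meet it, and one more vertex, whose degree is large, makes
      up for those ([same_heavy_bound]).
    - If T+ and T- differ, order the edges along trails.  When a trail passes
      through a vertex of T+ outside T-, two consecutive edges of the ordering
      meet there; if both are positive, then alternation lets only one of them
      count.  Hence such a vertex contributes only half its degree, and the
      sequence has length at most half the sum of the degrees over T+ and over
      T-, up to a constant depending on r ([trail_alternation]).  This is at
      most ex plus a constant.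
      The constant is recovered by starting the ordering with, for every
      vertex v, a large number of closed trails of length 8 that start at v and
      pass through v once more after four steps; those of the same vertex v
      share no other vertex.  For all but boundedly many of them v is the only
      vertex of T+ or T- on the trail, and then the alternating sequence uses
      one edge where half the degree would allow two
      ([clean_gadget_alternation], [different_heavy_bound]).

    The short closed trails are found greedily inside copies of K_{2,4}
    ([gadget_packing]), and the remaining edges are cut into trails such that
    every vertex is an end of at most two of them ([edge_trails]). *)

(** * Signed labels and the parity of alternating facets *)

Lemma involution_card_even (T : finType) (A : {set T}) (f : T -> T) :
    {in A, forall x, [/\ f x \in A, f (f x) = x & f x != x]} -> ~~ odd #|A|.
Proof.
have [n] := ubnP #|A|; elim: n A => // n IHn A ltAn Af.
have [->|/set0Pn[x xA]] := eqVneq A set0; first by rewrite cards0.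
have [fxA ffx fxx] := Af x xA.
have fxAx : f x \in A :\ x by rewrite !inE fxx.
rewrite (cardsD1 x) xA (cardsD1 (f x)) fxAx /= negbK.
apply: IHn => [|y]; first by move: ltAn; rewrite (cardsD1 x) xA (cardsD1 (f x)) fxAx; lia.
rewrite !inE => /and3P[yfx yx yA]; have [fyA ffy fyy] := Af y yA.
split=> //; rewrite fyA andbT; apply/andP; split.
  by apply: contraNneq yx => e; rewrite -ffy e ffx.
by apply: contraNneq yfx => e; rewrite -ffy e.
Qed.

Section AlternatingLabels.
Variable m : nat.
Implicit Types (mu : 'I_m * bool -> nat) (s : bool) (ts : seq 'I_m).

(** A multiset of signed labels is given by its multiplicities, so that
    deleting a vertex of a simplex lowers one multiplicity and no labels have
    to be sorted.  No label, up to sign, may occur twice. *)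
Fixpoint alternating_labels mu s ts : bool :=
  if ts is t :: ts' then
    if mu (t, true) + mu (t, false) == 0 then alternating_labels mu s ts'
    else [&& mu (t, s) == 1, mu (t, ~~ s) == 0 & alternating_labels mu (~~ s) ts']
  else true.

Definition decr mu l : 'I_m * bool -> nat := fun l' => mu l' - (l' == l).

Lemma eq_alternating_labels mu mu' s ts :
    (forall t b, t \in ts -> mu (t, b) = mu' (t, b)) ->
  alternating_labels mu s ts = alternating_labels mu' s ts.
Proof.
elim: ts s => //= t ts IHts s eq_mu.
have eqt b : mu (t, b) = mu' (t, b) by apply: eq_mu; rewrite mem_head.
have eqts s' : alternating_labels mu s' ts = alternating_labels mu' s' ts.
  by apply: IHts => t' b t'ts; apply: eq_mu; rewrite inE t'ts orbT.
by rewrite !eqt !eqts.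
Qed.

(** The local step of Ky Fan's parity argument.  The sum counts the facets of
    a simplex whose labels alternate starting with the sign s.  If the labels
    of the simplex alternate, deleting its first or its last label, depending
    on s, gives the only such facet; if they fail to alternate because of one
    repeated label or of two neighbouring equal signs, deleting either of the
    two has the same effect; otherwise no facet alternates.  The recursion on
    the list of labels covers all these cases at once, including that of the
    empty simplex, which alternates for both starting signs. *)
Lemma alternating_labels_parity mu s ts :
    uniq ts -> (forall t, mu (t, true) = 0 \/ mu (t, false) = 0) ->
  odd (\sum_(t <- ts) \sum_(b : bool)
         mu (t, b) * alternating_labels (decr mu (t, b)) s ts)
    = alternating_labels mu true ts (+) alternating_labels mu false ts.
Proof.
move=> + mu0; elim: ts s => [|t ts IHts] s /=; first by rewrite big_nil.
case/andP=> tts uts.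
rewrite big_cons oddD.
have decr_t b s' : alternating_labels (decr mu (t, b)) s' ts
    = alternating_labels mu s' ts.
  apply: eq_alternating_labels => t' b' t'ts.
  by rewrite /decr xpair_eqE (_ : (t' == t) = false) ?subn0 //;
     apply: contraNF tts => /eqP <-.
have decr_ts t' b' b : t' \in ts -> decr mu (t', b') (t, b) = mu (t, b).
  move=> t'ts; rewrite /decr xpair_eqE (_ : (t == t') = false) ?subn0 //.
  by apply: contraNF tts => /eqP ->.
have tail : odd (\sum_(t' <- ts) \sum_(b : bool) mu (t', b) *
      (if decr mu (t', b) (t, true) + decr mu (t', b) (t, false) == 0
       then alternating_labels (decr mu (t', b)) s ts
       else [&& decr mu (t', b) (t, s) == 1, decr mu (t', b) (t, ~~ s) == 0
             & alternating_labels (decr mu (t', b)) (~~ s) ts]))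
   = (if mu (t, true) + mu (t, false) == 0 then true
      else (mu (t, s) == 1) && (mu (t, ~~ s) == 0)) &&
     (alternating_labels mu true ts (+) alternating_labels mu false ts).
  set cnd := if _ then true else _.
  have [c0|nc0] := boolP (mu (t, true) + mu (t, false) == 0).
    rewrite /cnd c0 -(IHts s uts); congr odd.
    rewrite !big_seq; apply: eq_bigr => t' t'ts; apply: eq_bigr => b _.
    by rewrite !decr_ts // c0.
  rewrite /cnd (negPf nc0).
  have [c1|nc1] := boolP ((mu (t, s) == 1) && (mu (t, ~~ s) == 0)).
    rewrite -(IHts (~~ s) uts); congr odd.
    rewrite !big_seq; apply: eq_bigr => t' t'ts; apply: eq_bigr => b _.
    by rewrite !decr_ts // (negPf nc0) andbA c1.
  rewrite big_seq big1 // => t' t'ts; rewrite big1 // => b _.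
  by rewrite !decr_ts // (negPf nc0) andbA (negPf nc1) muln0.
rewrite tail big_bool /= !decr_t /decr !xpair_eqE !eqxx /= => {tail}.
case: s; move: (mu (t, true)) (mu (t, false)) (mu0 t) => p n /= [->|->];
  rewrite ?subn0 ?add0n ?addn0 ?mul0n ?addn0 /=.
- case: n => [|[|[|k]]]; rewrite ?mul1n ?oddM ?andbF //=;
  by case: (alternating_labels mu true ts); case: (alternating_labels mu false ts).
- case: p => [|[|[|k]]]; rewrite ?mul1n ?oddM ?andbF //=;
  by case: (alternating_labels mu true ts); case: (alternating_labels mu false ts).
- case: n => [|[|[|k]]]; rewrite ?mul1n ?oddM ?andbF //=;
  by case: (alternating_labels mu true ts); case: (alternating_labels mu false ts).
- case: p => [|[|[|k]]]; rewrite ?mul1n ?oddM ?andbF //=;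
  by case: (alternating_labels mu true ts); case: (alternating_labels mu false ts).
Qed.

Lemma alternating_labels_le mu s ts :
    alternating_labels mu s ts ->
  \sum_(t <- ts) \sum_(b : bool) mu (t, b) <= size ts.
Proof.
elim: ts s => [|t ts IHts] s; rewrite ?big_nil //= big_cons big_bool.
case: ifP => [/eqP e0 /IHts le_ts|_ /and3P[/eqP e1 /eqP e2 /IHts le_ts]].
  by rewrite [X in X + _]e0 add0n (leq_trans le_ts).
rewrite -add1n leq_add //; by case: s e1 e2 {le_ts} => /= -> ->.
Qed.
End AlternatingLabels.

(** * The octahedral Tucker lemma *)

Definition signvec N := {ffun 'I_N -> sign}.
Definition opp_signvec N (X : signvec N) : signvec N := [ffun k => omap negb (X k)].
Definition sub_signvec N (X Y : signvec N) := forall k b, X k = Some b -> Y k = Some b.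

Section Tucker.
Variables (N m : nat) (lam : signvec N -> 'I_m * bool).
Hypothesis lam_opp : forall (X : signvec N) k, X k != None ->
  lam (opp_signvec X) = ((lam X).1, ~~ (lam X).2).
Hypothesis lam_sub : forall (X Y : signvec N) k, X k != None -> sub_signvec X Y ->
  (lam X).1 = (lam Y).1 -> (lam X).2 = (lam Y).2.

Local Notation flag := ({perm 'I_N} * {ffun 'I_N -> bool})%type.
Implicit Types (c : flag) (i j k : 'I_N) (d : nat) (I : {set 'I_N}).

(** A flag (rho, s) is a maximal chain of nonzero sign vectors: coordinate k
    becomes nonzero at step rho k, with sign s k. *)
Definition flag_vertex c j : signvec N :=
  [ffun k => if c.1 k <= j then Some (c.2 k) else None].

Definition label_mult c (I : {set 'I_N}) (l : 'I_m * bool) : nat :=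
  #|[set j in I | lam (flag_vertex c j) == l]|.

Definition alternating_flag c I s : bool :=
  alternating_labels (label_mult c I) s (enum 'I_m).

Definition initial d : {set 'I_N} := [set j : 'I_N | j < d].

(** The first d vertices of these flags run over all maximal chains on the
    first d coordinates; the remaining steps are fixed, so that chains of all
    lengths live in the same type. *)
Definition flags d : {set flag} :=
  [set c : flag | [forall k : 'I_N, (d <= k) ==> (c.1 k == k) && c.2 k]].

Lemma flagsP d c : reflect (forall k, d <= k -> c.1 k = k /\ c.2 k) (c \in flags d).
Proof.
rewrite inE; apply: (iffP forallP) => cP k.
  by move=> dk; have /implyP/(_ dk)/andP[/eqP] := cP k.
by apply/implyP => /cP[-> ->]; rewrite eqxx.
Qed.

Lemma flag_vertex_neq0 c j : exists k, flag_vertex c j k != None.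
Proof. by exists ((c.1^-1)%g j); rewrite ffunE permKV leqnn. Qed.

Lemma flag_vertex_sub c i j : i <= j -> sub_signvec (flag_vertex c i) (flag_vertex c j).
Proof.
by move=> ij k b; rewrite !ffunE; case: ifP => // cki [<-]; rewrite (leq_trans cki ij).
Qed.

Lemma label_mult_compl c I t : label_mult c I (t, true) = 0 \/ label_mult c I (t, false) = 0.
Proof.
have [->|nz1] := eqVneq (label_mult c I (t, true)) 0; first by left.
have [->|nz2] := eqVneq (label_mult c I (t, false)) 0; first by right.
move: nz1 nz2; rewrite /label_mult !cards_eq0 => /set0Pn[i] + /set0Pn[j].
rewrite !inE => /andP[_ /eqP li] /andP[_ /eqP lj].
have [ij|/ltnW ji] := leqP i j.
  have [k Xk] := flag_vertex_neq0 c i.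
  by have := lam_sub Xk (flag_vertex_sub ij); rewrite li lj => /(_ erefl).
have [k Xk] := flag_vertex_neq0 c j.
by have := lam_sub Xk (flag_vertex_sub ji); rewrite li lj => /(_ erefl).
Qed.

Lemma label_mult_setD1 c I i l : i \in I ->
  label_mult c (I :\ i) l = decr (label_mult c I) (lam (flag_vertex c i)) l.
Proof.
move=> iI; rewrite /decr /label_mult.
rewrite [in RHS](cardsD1 i) !inE iI /= eq_sym addKn.
by apply: eq_card => j; rewrite !inE andbA.
Qed.

Lemma eq_alternating_flag c c' (I : {set 'I_N}) s :
    {in I, forall j, flag_vertex c j = flag_vertex c' j} ->
  alternating_flag c I s = alternating_flag c' I s.
Proof.
move=> cc'; apply: eq_alternating_labels => t b _.
by apply: eq_card => j; rewrite !inE; apply: andb_id2l => /cc' ->.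
Qed.

Lemma facet_parity c I s :
  odd (\sum_(i in I) alternating_flag c (I :\ i) s)
    = alternating_flag c I true (+) alternating_flag c I false.
Proof.
rewrite -(alternating_labels_parity s (enum_uniq 'I_m) (label_mult_compl c I)).
congr odd; rewrite big_enum /=.
rewrite pair_big /= (partition_big (fun i => lam (flag_vertex c i)) predT) //=.
apply: eq_big => [[t b] //|[t b] _].
rewrite /label_mult -sum1_card big_distrl /=.
apply: eq_big => [i|i /andP[iI /eqP li]]; first by rewrite !inE.
rewrite mul1n; congr nat_of_bool; apply: eq_alternating_labels => t' b' _.
by rewrite label_mult_setD1 // li.
Qed.

Definition pos_flags d : {set flag} :=
  [set c in flags d | alternating_flag c (initial d) true].

Definition opp_flag d c : flag :=
  (c.1, [ffun k : 'I_N => if k < d then ~~ c.2 k else c.2 k]).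

Lemma opp_flagK d : involutive (opp_flag d).
Proof.
move=> [r s]; congr pair; apply/ffunP => k; rewrite !ffunE.
by case: ifP => lt; rewrite ?lt ?negbK.
Qed.

Lemma opp_flag_in d c : (opp_flag d c \in flags d) = (c \in flags d).
Proof.
rewrite !inE; apply: eq_forallb => k /=; rewrite ffunE.
by case: (leqP d k).
Qed.

Lemma alternating_flag_opp d c s : c \in flags d ->
  alternating_flag (opp_flag d c) (initial d) s = alternating_flag c (initial d) (~~ s).
Proof.
move=> /flagsP cd; have mult t b : label_mult (opp_flag d c) (initial d) (t, b)
    = label_mult c (initial d) (t, ~~ b).
  apply: eq_card => j; rewrite !inE; apply: andb_id2l => jd.
  have -> : flag_vertex (opp_flag d c) j = opp_signvec (flag_vertex c j).
    apply/ffunP => k; rewrite !ffunE /=; case: ifP => //= ckj; case: ltnP => // dk.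
    by have [ek _] := cd k dk; move: ckj; rewrite ek; lia.
  have [k Xk] := flag_vertex_neq0 c j; rewrite (lam_opp Xk).
  by case: (lam _) => t' b'; rewrite !xpair_eqE; case: b b' => -[].
rewrite /alternating_flag; elim: (enum 'I_m) s => //= t ts IHts s.
by rewrite !mult IHts (IHts (~~ s)) addnC.
Qed.

Section Step.
Variables (d : 'I_N).

(** The chains of the hemisphere of the sphere on d + 1 coordinates that is
    bounded by the sphere on d coordinates. *)
Definition half_flags : {set flag} := [set c in flags d.+1 | c.2 d].

(** The facet opposite to an inner vertex X_i of a chain lies in exactly one
    other chain, which is obtained by exchanging steps i and i + 1. *)
Lemma swap_even i : i < d ->
  ~~ odd #|[set c in half_flags | alternating_flag c (initial d.+1 :\ i) true]|.
Proof.
move=> id; have i1N : i.+1 < N by apply: leq_ltn_trans id _.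
pose j := Ordinal i1N; have ij : i != j by rewrite -val_eqE /= neq_ltn ltnSn.
apply: (@involution_card_even _ _ (fun c => ((c.1 * tperm i j)%g, c.2))) => -[r s].
rewrite 2!inE => /andP[/andP[/flagsP rs /= sd] alt]; split.
- rewrite 2!inE sd -(@eq_alternating_flag (r, s)) ?alt ?andbT; last first.
    move=> k; rewrite !inE -val_eqE => /andP[/= ki _]; apply/ffunP => k'.
    rewrite !ffunE /= permM; case: tpermP => [->|->|//] /=; congr (if _ then _ else _);
      by move: ki; rewrite /=; lia.
  apply/flagsP => k dk; have [/= rk sk] := rs k dk; rewrite permM rk tpermD //.
    by apply: contraTneq dk => <-; lia.
  by apply: contraTneq dk => <-; rewrite /=; lia.
- by rewrite /= -mulgA tperm2 mulg1.
- rewrite -pair_eqE /= eqxx andbT eq_sym; apply: contra ij => /eqP.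
  rewrite -[LHS]mulg1 => /mulgI/permP/(_ i).
  by rewrite tpermL perm1 => ->.
Qed.

(** The facet opposite to the last vertex is shared with the chain in which
    the coordinate of the last step has the other sign.  That chain leaves the
    hemisphere exactly when this coordinate is d, and then the facet is a
    maximal chain of the bounding sphere. *)
Lemma flip_parity :
  odd #|[set c in half_flags | alternating_flag c (initial d.+1 :\ d) true]|
    = odd #|pos_flags d|.
Proof.
have init_d : initial d.+1 :\ d = initial d.
  by apply/setP => k; rewrite !inE -val_eqE /=; lia.
rewrite init_d; set A := finset _.
rewrite -(cardsID (flags d) A) oddD.
have -> : A :&: flags d = pos_flags d.
  apply/setP => c; rewrite in_setI [RHS]inE [c \in A]inE andbC.
  apply: andb_id2l => /flagsP cd; rewrite inE.
  have [_ ->] := cd d (leqnn d); rewrite andbT.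
  have -> : c \in flags d.+1 by apply/flagsP => k /ltnW/cd.
  by [].
rewrite addbC [odd #|A :\: _|](negbTE _) //.
pose flip c : flag := (c.1, [ffun k => if c.1 k == d then ~~ c.2 k else c.2 k]).
apply: (@involution_card_even _ _ flip) => -[r s].
rewrite in_setD => /andP[nf]; rewrite 2!inE => /andP[/andP[/flagsP rs /= sd] alt].
have rdd : r d != d.
  apply: contraNneq nf => rdd; apply/flagsP => k.
  by rewrite leq_eqVlt => /orP[/eqP/val_inj <-|/rs].
have rgt k : d < k -> r k != d.
  by move=> dk; have [/= -> _] := rs k dk; rewrite -val_eqE /= gtn_eqF.
have flipP : flip (r, s) \in flags d.+1.
  apply/flagsP => k dk; have [/= rk sk] := rs k dk.
  by rewrite /flip /= ffunE (negPf (rgt k dk)).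
split.
- rewrite in_setD; apply/andP; split.
    by apply: contra rdd => /flagsP/(_ d (leqnn d))[/= -> _]; exact: eqxx.
  rewrite 2!inE flipP /= ffunE (negPf rdd) sd /= -(@eq_alternating_flag (r, s)) //.
  move=> k; rewrite inE => kd; apply/ffunP => k'; rewrite !ffunE /=.
  by case: ifP => // rk'; rewrite ifN //; apply: contraTneq rk' => ->; rewrite -ltnNge.
- rewrite /flip /=; congr pair; apply/ffunP => k; rewrite !ffunE.
  by case: (r k == d) => //=; exact: negbK.
- apply/eqP => -[/ffunP/(_ ((r^-1)%g d))].
  by rewrite ffunE permKV eqxx; case: (s _).
Qed.

(** Antipodality exchanges positively alternating chains of the lower
    hemisphere with negatively alternating chains of the upper one. *)
Lemma half_flags_parity :
  odd #|[set c in half_flags | alternating_flag c (initial d.+1) true]|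
    (+) odd #|[set c in half_flags | alternating_flag c (initial d.+1) false]|
    = odd #|pos_flags d.+1|.
Proof.
rewrite -(cardsID half_flags (pos_flags d.+1)) oddD; congr (odd _ (+) odd _).
  apply: eq_card => c; rewrite in_setI [c \in pos_flags _]inE inE [c \in half_flags]inE.
  by case: (c \in flags _); case: (c.2 d); case: (alternating_flag _ _ _).
rewrite -(card_imset _ (inv_inj (opp_flagK d.+1))); apply: eq_card => c.
rewrite -[in LHS](opp_flagK d.+1 c) mem_imset; last exact: inv_inj (opp_flagK d.+1).
rewrite in_setD [c \in pos_flags _]inE inE [c \in half_flags]inE.
rewrite [_ \in half_flags]inE opp_flag_in /= ffunE ltnSn.
have [cd|] := boolP (c \in flags d.+1); last by rewrite !andbF.
by rewrite (alternating_flag_opp _ cd); case: (c.2 d).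
Qed.

(** Count in two ways the pairs of a chain of the hemisphere and a positively
    alternating facet of it. *)
Lemma pos_flags_step : odd #|pos_flags d.+1| = odd #|pos_flags d|.
Proof.
rewrite -half_flags_parity -flip_parity.
pose F c i := nat_of_bool (alternating_flag c (initial d.+1 :\ i) true).
have sumF i : \sum_(c in half_flags) F c i
    = #|[set c in half_flags | alternating_flag c (initial d.+1 :\ i) true]|.
  rewrite -sum1_card big_mkcond [RHS]big_mkcond /=; apply: eq_bigr => c _.
  by rewrite [in RHS]inE /F; case: (c \in half_flags) => //=; case: (alternating_flag _ _ _).
have : odd (\sum_(c in half_flags) \sum_(i in initial d.+1) F c i)
     = odd (\sum_(i in initial d.+1) \sum_(c in half_flags) F c i).
  by rewrite exchange_big.
rewrite (bigD1 d) ?inE //= oddD sumF.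
rewrite [X in _ = _ (+) X](_ : _ = false) ?addbF => [<-|]; last first.
  rewrite (big_morph odd oddD (erefl : odd 0 = false)) big1 // => i.
  rewrite inE ltnS => /andP[id1 neid]; rewrite sumF; apply: negbTE; apply: swap_even.
  by rewrite ltn_neqAle -val_eqE in neid *; rewrite neid.
rewrite (big_morph odd oddD (erefl : odd 0 = false)).
rewrite (eq_bigr (fun c => alternating_flag c (initial d.+1) true
          (+) alternating_flag c (initial d.+1) false)); last first.
  by move=> c _; rewrite facet_parity.
rewrite big_split /=; congr addb.
  rewrite -sum1_card (big_morph odd oddD (erefl : odd 0 = false)).
  rewrite big_mkcond [RHS]big_mkcond; apply: eq_bigr => c _; rewrite [in LHS]inE.
  by case: (c \in half_flags); case: (alternating_flag _ _ _).
rewrite -sum1_card (big_morph odd oddD (erefl : odd 0 = false)).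
rewrite big_mkcond [RHS]big_mkcond; apply: eq_bigr => c _; rewrite [in LHS]inE.
by case: (c \in half_flags); case: (alternating_flag _ _ _).
Qed.
End Step.

Lemma pos_flags_odd d : d <= N -> odd #|pos_flags d|.
Proof.
elim: d => [|d IHd] dN; last first.
  by rewrite -[d]/(val (Ordinal dN)) pos_flags_step IHd // ltnW.
suff -> : pos_flags 0 = [set (1%g, [ffun=> true])] by rewrite cards1.
apply/setP => -[r s]; rewrite in_set1 inE andbC.
have -> : alternating_flag (r, s) (initial 0) true.
  rewrite /alternating_flag; elim: (enum 'I_m) => //= t ts IHts.
  have mult0 b : label_mult (r, s) (initial 0) (t, b) = 0.
    by apply: eq_card0 => j; rewrite !inE.
  by rewrite !mult0.
apply/flagsP/eqP => [rs|[-> ->] k _]; last by rewrite perm1 ffunE.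
congr pair; first by apply/permP => k; rewrite perm1; have [] := rs k (leq0n _).
by apply/ffunP => k; rewrite ffunE; have [] := rs k (leq0n _).
Qed.

(** An odd number of flags carries N labels that alternate, hence are pairwise
    different up to sign. *)
Theorem octahedral_tucker : N <= m.
Proof.
have [c] : exists c, c \in pos_flags N.
  by apply/existsP; have := pos_flags_odd (leqnn N); case: existsP => // nE; 
     rewrite eq_card0 // => c; apply/negP => cN; case: nE; exists c.
rewrite inE => /andP[_ /alternating_labels_le].
rewrite size_enum_ord; apply: leq_trans; rewrite big_enum /= pair_big /=.
rewrite -[leqLHS]card_ord -sum1_card (partition_big (fun i => lam (flag_vertex c i)) predT) //=.
apply: eq_leq; apply: eq_bigr => -[t b] _; rewrite sum1_card.
by apply: eq_card => j; rewrite !inE ltn_ord.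
Qed.
End Tucker.

Lemma octahedral_tucker_nat N m (lam : signvec N -> nat * bool) :
    (forall (X : signvec N) k, X k != None -> (lam X).1 < m) ->
    (forall (X : signvec N) k, X k != None ->
       lam (opp_signvec X) = ((lam X).1, ~~ (lam X).2)) ->
    (forall (X Y : signvec N) k, X k != None -> sub_signvec X Y ->
       (lam X).1 = (lam Y).1 -> (lam X).2 = (lam Y).2) ->
  N <= m.
Proof.
case: N lam => // N lam lam_lt lam_opp lam_sub.
case: m lam_lt => [|m] lam_lt.
  have X0 : [ffun=> Some true] (@ord0 N) != None :> sign by rewrite ffunE.
  by have := lam_lt _ _ X0; rewrite ltn0.
pose lam' X : 'I_m.+1 * bool := (inord (lam X).1, (lam X).2).
apply: (@octahedral_tucker _ _ lam') => [X k Xk|X Y k Xk XY].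
  by rewrite /lam' (lam_opp X k Xk).
have [j Yj] : exists j, Y j != None.
  by exists k; case E: (X k) Xk => [b|//] _; rewrite (XY _ _ E).
move=> /(congr1 val); rewrite /= !inordK ?(lam_lt _ _ Xk) ?(lam_lt _ _ Yj) //.
exact: lam_sub Xk XY.
Qed.

(** * The altermatic lower bound for the chromatic number *)

(** The longest alternating subsequence that starts with the sign a: it is
    optimal to take each term of the sign awaited as soon as it occurs.
    Reading a as a state that flips at every term taken makes the count
    additive along concatenations. *)
Fixpoint greedy_alt (a : bool) (X : seq sign) : nat :=
  if X is x :: X' then
    if x == Some a then (greedy_alt (~~ a) X').+1 else greedy_alt a X'
  else 0.

Lemma greedy_alt_negb a X : greedy_alt a X <= (greedy_alt (~~ a) X).+1.
Proof.
elim: X a => //= x X IHX a.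
have := IHX true; have := IHX false.
by case: x a => [[]|] [] /=; lia.
Qed.

Lemma greedy_alt_sub a X Y : size X = size Y ->
    (forall i b, nth None X i = Some b -> nth None Y i = Some b) ->
  greedy_alt a X <= greedy_alt a Y.
Proof.
elim: X Y a => [|x X IHX] [|y Y] a //= [eq_sz] XY.
have {}IHX a' : greedy_alt a' X <= greedy_alt a' Y.
  by apply: IHX => // i; apply: (XY i.+1).
have [/(XY 0)/= ->|xa] := x =P Some a; first by rewrite eqxx ltnS.
case: eqP => // _; exact: leq_trans (IHX _) (greedy_alt_negb _ _).
Qed.

(** The sign of the first nonzero term starts the strictly longer
    subsequence, so comparing the two counts recovers that sign. *)
Lemma greedy_alt_neq X : has isSome X -> greedy_alt true X != greedy_alt false X.
Proof.
elim: X => //= -[[]|] X IHX //= _; first by rewrite eqn_leq ltnn.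
by rewrite eqn_leq ltnn andbF.
Qed.

Lemma greedy_alt_opp a X : greedy_alt a (map (omap negb) X) = greedy_alt (~~ a) X.
Proof. by elim: X a => //= -[[]|] X IHX [] //=; rewrite IHX. Qed.

Lemma greedy_alt_attained a X : exists m : bitseq,
  [/\ size m = size X, all isSome (mask m X),
      path (fun x y => x != y) (Some (~~ a)) (mask m X)
    & size (mask m X) = greedy_alt a X].
Proof.
elim: X a => [|x X IHX] a; first by exists [::].
rewrite /=; case: eqP => [->|_].
  have [m [sm am pm <-]] := IHX (~~ a); exists (true :: m).
  by split; rewrite /= ?sm // negbK in pm *; rewrite pm; case: a {pm}.
by have [m [sm am pm <-]] := IHX a; exists (false :: m); split; rewrite /= ?sm.
Qed.

Lemma alternating_mask_le a X m : all isSome (mask m X) ->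
    path (fun x y => x != y) (Some (~~ a)) (mask m X) ->
  size (mask m X) <= greedy_alt a X.
Proof.
elim: X a m => [|x X IHX] a [|[] m] //=; last first.
  move=> am pm; have := IHX a m am pm; case: eqP => // _ le.
  exact: leq_trans le (greedy_alt_negb _ _).
case: x => // b am /andP[ab]; have -> : b = a by case: (a) (b) ab => -[].
by move=> pm; rewrite eqxx ltnS IHX // negbK.
Qed.

Definition max_alt X := maxn (greedy_alt true X) (greedy_alt false X).

Lemma alt_length_greedy N (X : N.-tuple sign) : alt_length X = max_alt X.
Proof.
apply/eqP; rewrite eqn_leq; apply/andP; split.
  apply/bigmax_leqP => m /andP[am sm]; rewrite leq_max.
  case E: (mask m X) am sm => [|[b|] t] //= am sm.
  have : size (mask m X) <= greedy_alt b X.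
    apply: alternating_mask_le; rewrite E //=; rewrite sm andbT.
    by case: (b).
  by rewrite E /=; case: (b) => ->; rewrite ?orbT.
rewrite geq_max; have attained a : greedy_alt a X <= alt_length X.
  have [m [sm am pm <-]] := greedy_alt_attained a X.
  have sm' : size m == N by rewrite sm size_tuple.
  apply: (leq_bigmax_cond (Tuple sm')) => /=; rewrite /alternating am /=.
  exact: path_sorted pm.
by rewrite !attained.
Qed.

Section AltermaticBound.
Variables (H : hypergraph) (s : #|hvertex H|.-tuple (hvertex H)) (C : nat).
Hypothesis uniq_s : uniq s.
Local Notation N := #|hvertex H|.
Local Notation a := (alt_ordering s).
Local Notation K := (kneser (hedges H)).
Variable c : {ffun K -> 'I_C}.
Hypothesis c_proper : forall x y : K, adj x y -> c x != c y.

Implicit Types X Y : signvec N.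

Let tup X : N.-tuple sign := [tuple X i | i < N].
Let part X b := sign_part s (tup X) b.

Let partP X b v : reflect (exists2 j, X j = Some b & v = tnth s j) (v \in part X b).
Proof.
apply: (iffP imsetP) => [[j]|[j Xj ->]]; first by rewrite inE tnth_mktuple => /eqP Xj ->; exists j.
by exists j; rewrite // inE tnth_mktuple Xj.
Qed.

Let part_sub X Y b : sub_signvec X Y -> part X b \subset part Y b.
Proof. by move=> XY; apply/subsetP => v /partP[j /XY Yj ->]; apply/partP; exists j. Qed.

Let part_opp X b : part (opp_signvec X) b = part X (~~ b).
Proof.
apply/setP => v; apply/partP/partP => -[j Xj ->]; exists j => //; move: Xj; rewrite ffunE.
  by case: (X j) => //= b' [<-]; rewrite negbK.
by move=> ->; rewrite /= negbK.
Qed.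

Let part_disjoint X : [disjoint part X true & part X false].
Proof.
rewrite -setI_eq0 -subset0; apply/subsetP => v /setIP[/partP[i Xi ->] /partP[j Xj]].
by move=> /(tuple_uniqP _ uniq_s) ij; rewrite ij Xj in Xi.
Qed.

Let caught X (e : K) := (val e \subset part X true) || (val e \subset part X false).

(* A sign vector with at most a alternations is labelled by their number and
   its first sign, any other one by the colour of a hyperedge contained in one
   of its parts and the sign of that part. *)
Let lam X : nat * bool :=
  if max_alt (tup X) <= a then
    ((max_alt (tup X)).-1, greedy_alt false (tup X) < greedy_alt true (tup X))
  else if [pick e | caught X e] is Some e then (a + c e, val e \subset part X true)
  else (0, true).

Let tup_some X k : X k != None -> has isSome (tup X).
Proof.
move=> Xk; apply/hasP; exists (X k); last by case: (X k) Xk.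
by rewrite -(tnth_mktuple X); apply: mem_tnth.
Qed.

Let max_alt_gt0 X k : X k != None -> 0 < max_alt (tup X).
Proof.
by move=> /tup_some/greedy_alt_neq; rewrite /max_alt; lia.
Qed.

Let caughtP X : a < max_alt (tup X) -> exists2 e, [pick e | caught X e] = Some e & caught X e.
Proof.
move=> lt_a; case: pickP => [e ce|nce]; first by exists e.
suff : max_alt (tup X) <= a by rewrite leqNgt lt_a.
rewrite -alt_length_greedy; apply: leq_bigmax_cond.
apply/forallP => e; apply/implyP => eE; apply/forallP => b; apply: contraFN (nce (Sub e eE)) => eb.
by rewrite /caught /=; case: b eb; rewrite /part => ->; rewrite ?orbT.
Qed.

Let edge_neq0 (e : K) : val e != set0.
Proof. by apply: contraTneq (valP e) => ->; exact: hedges_neq0. Qed.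

Let edge_disjoint X (e e' : K) : val e \subset part X true -> val e' \subset part X false ->
  adj e e'.
Proof.
move=> eX e'X; have dis : [disjoint val e & val e'].
  by apply: disjointWl eX _; apply: disjointWr e'X _; apply: part_disjoint.
rewrite /= /kneser_adj dis andbT; apply: contraNneq (edge_neq0 e) => ee'.
by rewrite -subset0 -(disjoint_setI0 dis) -ee' setIid.
Qed.

(** Two comparable sign vectors with the same number of alternations have the
    same first sign, and two hyperedges in opposite parts of comparable sign
    vectors are disjoint, hence have different colours.  So Tucker's lemma
    applies to the labelling above, which uses a + C labels. *)
Lemma altermatic_colors : N <= a + C.
Proof.
apply: (@octahedral_tucker_nat _ _ lam) => [X k Xk|X k Xk|X Y k Xk XY].
- rewrite /lam; have g0 := max_alt_gt0 Xk; case: (leqP (max_alt (tup X)) a) => [ga|/caughtP[e -> _]].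
    by rewrite /= prednK // (leq_trans ga) ?leq_addr.
  by rewrite ltn_add2l.
- have opp_tup : tup (opp_signvec X) = map (omap negb) (tup X) :> seq _.
    by rewrite -map_comp; apply: eq_map => i /=; rewrite ffunE.
  have oppg b : greedy_alt b (tup (opp_signvec X)) = greedy_alt (~~ b) (tup X).
    by rewrite opp_tup greedy_alt_opp.
  have oppm : max_alt (tup (opp_signvec X)) = max_alt (tup X).
    by rewrite /max_alt !oppg maxnC.
  rewrite /lam oppm; case: (leqP (max_alt (tup X)) a) => [_|lta].
    rewrite !oppg /=; congr pair; rewrite -leqNgt ltn_neqAle.
    by rewrite (greedy_alt_neq (tup_some Xk)).
  have [e eE ce] := caughtP lta.
  rewrite (@eq_pick _ _ (caught X)); last by move=> e'; rewrite /caught !part_opp orbC.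
  rewrite eE /=; congr pair; rewrite part_opp.
  case/orP: ce => ce; rewrite ce.
    apply/negbTE/negP => ce'; have := edge_disjoint ce ce'.
    by rewrite adj_irr.
  apply/esym/negP => ce'; have := edge_disjoint ce' ce.
  by rewrite adj_irr.
have leg b : greedy_alt b (tup X) <= greedy_alt b (tup Y).
  apply: greedy_alt_sub => [|i b']; first by rewrite !size_tuple.
  have [iN|Ni] := ltnP i N; last by rewrite nth_default ?size_tuple.
  by rewrite -!(tnth_nth _ _ (Ordinal iN)) !tnth_mktuple => /XY.
have [j Yj] : exists j, Y j != None.
  by exists k; case E: (X k) Xk => [b|//] _; rewrite (XY _ _ E).
have := max_alt_gt0 Xk; have := max_alt_gt0 Yj.
have := greedy_alt_neq (tup_some Xk); have := greedy_alt_neq (tup_some Yj).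
move: (leg true) (leg false); rewrite /lam.
have cX := @caughtP X; have cY := @caughtP Y.
case: (leqP (max_alt (tup X)) a) cX => [Xa _|_ /(_ isT)[e -> eX]];
  case: (leqP (max_alt (tup Y)) a) cY => [Ya _|_ /(_ isT)[e' -> e'Y]] /=.
- by move: Xa Ya; rewrite /max_alt; lia.
- move=> _ _ _ _ _ X0 e; have := leq_addr (c e') a.
  by rewrite -e leqNgt prednK // Xa.
- move=> _ _ _ _ Y0 _ e'; have := leq_addr (c e) a.
  by rewrite e' leqNgt prednK // Ya.
move=> _ _ _ _ _ _ /eqP; rewrite eqn_add2l => /eqP/val_inj cee'.
case eT: (val e \subset part X true); case e'T: (val e' \subset part Y true) => //.
  have /edge_disjoint : val e \subset part Y true := subset_trans eT (part_sub _ XY).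
  by move: e'Y; rewrite /caught e'T => /= /[swap] /[apply] /c_proper; rewrite cee' eqxx.
move: eX; rewrite /caught eT /= => /subset_trans/(_ (part_sub _ XY)) eF.
by have /c_proper := edge_disjoint e'T eF; rewrite cee' eqxx.
Qed.
End AltermaticBound.

Lemma chromatic_numberP (F : sgraph) : colorable F (chromatic_number F).
Proof. by rewrite /chromatic_number; case: ex_minnP. Qed.

Lemma chromatic_number_min (F : sgraph) k : colorable F k -> chromatic_number F <= k.
Proof. by rewrite /chromatic_number; case: ex_minnP => m _ /[apply]. Qed.

Lemma chromatic_number_hom (F1 F2 : sgraph) (h : F1 -> F2) :
  is_hom h -> chromatic_number F1 <= chromatic_number F2.
Proof.
move=> hom_h; apply: chromatic_number_min.
have /existsP[c /forallP cP] := chromatic_numberP F2.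
apply/existsP; exists [ffun x => c (h x)]; apply/forallP => x; apply/forallP => y.
by apply/implyP => /hom_h xy; rewrite !ffunE; move/forallP: (cP (h x)) => /(_ (h y))/implyP; exact.
Qed.

Theorem alt_number_chromatic (H : hypergraph) :
  #|hvertex H| <= alt_number H + chromatic_number (kneser (hedges H)).
Proof.
rewrite /alt_number; elim/big_rec: _ => [|s k us IH]; first exact: leq_addr.
rewrite addn_minl leq_min IH andbT.
have /existsP[c /forallP cP] := chromatic_numberP (kneser (hedges H)).
apply: (altermatic_colors us (c := c)) => x y xy.
by move/forallP: (cP x) => /(_ y)/implyP; exact.
Qed.

(** * Edge sets without r disjoint edges *)

Section GraphBasics.
Variable G : sgraph.
Implicit Types (v w x y : G) (e : {set G}) (P M : {set {set G}}) (S T W : {set G}).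

Lemma edgesP e : reflect (exists x y, adj x y /\ e = [set x; y]) (e \in edges G).
Proof.
rewrite inE; apply: (iffP existsP) => [[x /existsP[y /andP[xy /eqP->]]]|[x [y [xy ->]]]].
  by exists x, y.
by exists x; apply/existsP; exists y; rewrite xy eqxx.
Qed.

Lemma adj_neq x y : adj x y -> x != y.
Proof. by apply: contraTneq => ->; rewrite adj_irr. Qed.

Lemma adj_edge x y : adj x y -> [set x; y] \in edges G.
Proof. by move=> xy; apply/edgesP; exists x, y. Qed.

Lemma card_edge e : e \in edges G -> #|e| = 2.
Proof. by move=> /edgesP[x [y [/adj_neq xy ->]]]; rewrite cards2 xy. Qed.

Lemma edge_at e v : e \in edges G -> v \in e -> exists2 w, adj v w & e = [set v; w].
Proof.
move=> /edgesP[x [y [xy ->]]]; rewrite !inE => /orP[]/eqP->; first by exists y.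
by exists x; rewrite 1?adj_sym // setUC.
Qed.

Definition incident P v : {set {set G}} := [set e in P | v \in e].
Definition meeting P S : {set {set G}} := [set e in P | ~~ [disjoint e & S]].

Definition matching_free r P := forall M, M \in matchings G r -> ~~ (M \subset P).

Lemma min_degree_le v : min_degree G <= #|neighbors v|.
Proof.
rewrite /min_degree; elim: (index_enum G) (mem_index_enum v) => //= x xs IHxs.
rewrite inE big_cons geq_min => /orP[/eqP->|/IHxs->]; first by rewrite leqnn.
exact: orbT.
Qed.

Lemma card_incident v : #|incident (edges G) v| = #|neighbors v|.
Proof.
rewrite -(card_in_imset (f := fun w => [set v; w]) (D := mem (neighbors v))).
  apply: eq_card => e; apply/idP/imsetP => [|[w]].
    by rewrite inE => /andP[eE /(edge_at eE)[w vw ->]]; exists w; rewrite ?inE.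
  move=> wv ->; have vw : adj v w by rewrite !inE in wv.
  by rewrite inE (adj_edge vw) set21.
move=> w w'; rewrite !inE => vw _ /setP/(_ w); rewrite !inE eqxx orbT.
by rewrite eq_sym (negPf (adj_neq vw)) => /esym/eqP.
Qed.

Lemma incident_avoiding P v W : P \subset edges G -> #|W| < #|incident P v| ->
  exists e, [/\ e \in P, v \in e & [disjoint e & W :\ v]].
Proof.
move=> PE; have [/exists_inP[e]|/exists_inPn nE] :=
  boolP [exists e in incident P v, [disjoint e & W :\ v]].
  by rewrite inE => /andP[eP ve] dis; exists e.
rewrite ltnNge (leq_trans _ (leq_imset_card (fun w => [set v; w]) W)) //.
apply/subset_leq_card/subsetP => e ePv; have := nE e ePv; rewrite -setI_eq0.
move: ePv; rewrite inE => /andP[eP ve] /set0Pn[w /setIP[we /setD1P[wv wW]]].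
have [w' _ ee] := edge_at (subsetP PE e eP) ve.
by apply/imsetP; exists w => //; move: we; rewrite ee !inE (negPf wv) => /eqP->.
Qed.

(** Disjoint edges that meet S meet it in different vertices. *)
Lemma star_turan r S : #|S| < r -> #|meeting (edges G) S| <= turan_matching G r.
Proof.
move=> Sr; apply: (leq_bigmax_cond (meeting (edges G) S)) => /=.
apply/andP; split; first by apply/subsetP => e /setIdP[].
apply/forall_inP => M; rewrite inE => /and3P[_ /eqP cM tM].
apply: contraL Sr => MS; rewrite -leqNgt -cM.
pose g e := [pick v in e :&: S].
have gP e : e \in M -> exists2 v, g e = Some v & v \in e :&: S.
  move=> /(subsetP MS); rewrite inE => /andP[_]; rewrite -setI_eq0 => /set0Pn[v vS].
  by rewrite /g; case: pickP => [w wS|/(_ v)]; [exists w | rewrite vS].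
rewrite -(card_in_imset (f := g)) => [|e e' eM e'M gg].
  rewrite -(card_imset S (@Some_inj _)); apply/subset_leq_card/subsetP => _ /imsetP[e eM ->].
  by have [v -> /setIP[_ vS]] := gP e eM; apply: imset_f.
have [v ge /setIP[ve _]] := gP e eM; have [v' ge' /setIP[ve' _]] := gP e' e'M.
move: gg; rewrite ge ge' => -[vv']; rewrite -vv' in ve'.
by rewrite -(def_pblock tM eM ve) (def_pblock tM e'M ve').
Qed.

Lemma card_cover_le M : M \subset edges G -> #|cover M| <= 2 * #|M|.
Proof.
move=> ME; apply: leq_trans (leq_card_cover M) _.
by rewrite mulnC -sum_nat_const leq_sum // => e /(subsetP ME)/card_edge->.
Qed.

(** Greedy extension: as long as fewer than r edges are chosen, the vertices
    covered so far and those of S number less than 2r, so the next vertex of S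
    has an edge avoiding all of them. *)
Lemma extend_matching r P M S : P \subset edges G -> M \subset P -> trivIset M ->
    [disjoint cover M & S] -> {in S, forall v, r.*2 <= #|incident P v|} ->
    #|M| + #|S| <= r ->
  exists M', [/\ M' \subset P, trivIset M' & #|M'| = #|M| + #|S|].
Proof.
move=> PE; have [n] := ubnP #|S|; elim: n S M => // n IHn S M ltSn MP tM dMS Sdeg Mr.
have [->|/set0Pn[v vS]] := eqVneq S set0; first by exists M; rewrite cards0 addn0.
have cS : #|S| = #|S :\ v|.+1 by rewrite (cardsD1 v) vS.
have [|e [eP ve de]] := @incident_avoiding P v (cover M :|: S) PE.
  apply: leq_trans (Sdeg v vS); apply: leq_ltn_trans (leq_card_setU _ _) _.
  have := card_cover_le (subset_trans MP PE); lia.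
have vM : v \notin cover M by rewrite (disjointFl dMS).
have deM : [disjoint e & cover M].
  apply: disjointWr de; rewrite setDUl; apply: subset_trans (subsetUl _ _).
  by apply/subsetP => x xM; rewrite !inE xM andbT; apply: contraNneq vM => <-.
have eM : e \notin M by apply: contra vM => eM; apply/bigcupP; exists e.
have [||||||M' [M'P tM' cM']] := IHn (S :\ v) (e |: M).
- by rewrite cS in ltSn.
- by rewrite subUset sub1set eP.
- have e0M : set0 \notin M.
    by apply/negP => /(subsetP MP)/(subsetP PE)/card_edge; rewrite cards0.
  have [] // := @trivIsetU1 _ e M _ tM e0M.
  by move=> B BM; apply: disjointWr deM; apply: bigcup_sup BM.
- rewrite /cover bigcup_setU big_set1 -setI_eq0 setIUl setU_eq0 !setI_eq0.
  rewrite (disjointWr _ de) ?(disjointWr _ dMS) ?subsetDl //.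
  by rewrite setSD // subsetUr.
- by move=> w /setD1P[_]; apply: Sdeg.
- by rewrite cardsU1 eM add1n addSnnS -cS.
by exists M'; split=> //; rewrite cM' cardsU1 eM add1n addSnnS -cS.
Qed.

(** The threshold 2r is what the greedy extension of matchings requires. *)
Definition heavy r P : {set G} := [set v | r.*2 <= #|incident P v|].

Section Heavy.
Variables (r : nat) (P : {set {set G}}).
Hypotheses (r_gt0 : 0 < r) (PE : P \subset edges G) (P_free : matching_free r P).

Lemma no_matching M : M \subset P -> trivIset M -> #|M| != r.
Proof.
move=> MP tM; apply/eqP => cM.
have : M \in matchings G r by rewrite inE (subset_trans MP PE) cM eqxx.
by move=> /P_free; rewrite MP.
Qed.

Lemma card_heavy : #|heavy r P| < r.
Proof.
rewrite ltnNge; apply/negP => hr.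
have [S SP cS] : exists2 S : {set G}, S \subset heavy r P & #|S| = r.
  exists [set x in take r (enum (heavy r P))].
    by apply/subsetP => x; rewrite inE => /mem_take; rewrite mem_enum.
  rewrite cardsE (card_uniqP _) ?take_uniq ?enum_uniq // size_take -cardE.
  by case: ltngtP hr.
have [|||||M [MP tM]] := @extend_matching r P set0 S PE; first exact: sub0set.
- by apply/trivIsetP => ?; rewrite inE.
- by rewrite /cover big_set0 -setI_eq0 set0I.
- by move=> v /(subsetP SP); rewrite inE.
- by rewrite cards0 cS.
by rewrite cards0 cS add0n => /eqP; rewrite (negPf (no_matching MP tM)).
Qed.

(** An edge that misses r - 1 heavy vertices extends, together with one edge
    at each of them, to r disjoint edges. *)
Lemma heavy_cover : #|heavy r P|.+1 = r -> P = meeting P (heavy r P).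
Proof.
move=> hr; apply/setP => e; rewrite inE; case eP: (e \in P) => //=.
apply/esym/negP => de.
have [|||||M [MP tM]] := @extend_matching r P [set e] (heavy r P) PE.
- by rewrite sub1set.
- by apply/trivIsetP => A B /set1P-> /set1P->; rewrite eqxx.
- by rewrite /cover big_set1.
- by move=> v; rewrite inE.
- by rewrite cards1 add1n hr.
by rewrite cards1 add1n hr => /eqP; rewrite (negPf (no_matching MP tM)).
Qed.

(** The fewer than 2r vertices of a maximal matching meet all edges, and those
    that are not heavy have degree less than 2r. *)
Lemma card_light : #|P :\: meeting P (heavy r P)| <= 4 * r ^ 2.
Proof.
pose p M := [&& M \subset P, trivIset M & #|M| <= r].
have p0 : p set0.
  by rewrite /p sub0set cards0 leq0n andbT; apply/trivIsetP => ?; rewrite inE.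
have [M /maxsetP[/and3P[MP tM cM] maxM] _] := maxset_exists p0.
have {}cM : #|M| < r by rewrite ltn_neqAle (no_matching MP tM).
have cover_meets e : e \in P -> ~~ [disjoint e & cover M].
  move=> eP; apply/negP => de.
  have e2 := card_edge (subsetP PE e eP).
  have M0 : set0 \notin M.
    by apply/negP => /(subsetP MP)/(subsetP PE)/card_edge; rewrite cards0.
  have [|tM' eM] := @trivIsetU1 _ e M _ tM M0.
    by move=> B BM; apply: disjointWr de; apply: bigcup_sup BM.
  have := maxM (e |: M); rewrite /p subUset sub1set eP MP tM' cardsU1 eM add1n cM.
  by move=> /(_ isT (subsetUr _ _)) eMM; rewrite -eMM setU11 in eM.
pose W := cover M :\: heavy r P.
have sub : P :\: meeting P (heavy r P) \subset \bigcup_(v in W) incident P v.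
  apply/subsetP => e; rewrite !inE => /andP[nm eP]; rewrite eP /= negbK in nm.
  have := cover_meets e eP; rewrite -setI_eq0 => /set0Pn[v /setIP[ve vM]].
  apply/bigcupP; exists v; last by rewrite inE eP.
  by rewrite inE vM andbT (disjointFr nm ve).
apply: leq_trans (subset_leq_card sub) _.
apply: leq_trans (_ : \sum_(v in W) #|incident P v| <= _).
  by elim/big_rec2: _ => [|v n B _ le]; rewrite ?cards0 // (leq_trans (leq_card_setU _ _)) // leq_add2l.
apply: leq_trans (_ : \sum_(v in W) r.*2 <= _).
  by apply: leq_sum => v; rewrite !inE -ltnNge => /andP[/ltnW].
rewrite sum_nat_const; have : #|W| <= r.*2.
  apply: leq_trans (subset_leq_card (subsetDl _ _)) _.
  by have := card_cover_le (subset_trans MP PE); lia.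
by nia.
Qed.
End Heavy.
End GraphBasics.

(** * Decomposing an edge set into trails *)

Section Walks.
Variable G : sgraph.
Implicit Types (v x y : G) (w p q : seq G) (W : seq (seq G)).

Fixpoint walk_edges w : seq {set G} :=
  if w is x :: w' then
    if w' is y :: _ then [set x; y] :: walk_edges w' else [::]
  else [::].

Definition is_walk w : bool := if w is x :: p then path (@adj G) x p else false.

(** A closed walk counts twice at its base point. *)
Definition ends v w : nat :=
  if w is x :: p then (x == v) + (last x p == v) else 0.

Definition all_edges W : seq {set G} := flatten (map walk_edges W).

Lemma walk_edges_cat p x q :
  walk_edges (p ++ x :: q) = walk_edges (rcons p x) ++ walk_edges (x :: q).
Proof. by elim: p => //= y [|z p] //= ->. Qed.

Lemma walk_edges_rev w : walk_edges (rev w) = rev (walk_edges w).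
Proof.
elim: w => //= x [|y w] //= IHw.
rewrite [LHS](_ : _ = walk_edges (rev w ++ y :: [:: x])); last first.
  by rewrite !rev_cons -!cats1 -catA.
by rewrite walk_edges_cat -rev_cons IHw [RHS]rev_cons -cats1 /= setUC.
Qed.

Lemma is_walk_rev w : is_walk (rev w) = is_walk w.
Proof.
case: w => // x p; rewrite lastI rev_rcons -lastI /= rev_path.
by apply: eq_path => a b; rewrite adj_sym.
Qed.

Lemma walk_from v w : is_walk w -> 0 < ends v w ->
  exists q, is_walk (v :: q) /\ perm_eq (walk_edges (v :: q)) (walk_edges w).
Proof.
case: w => // x p xp; rewrite /ends addn_gt0 !lt0b => /orP[/eqP<-|/eqP lv]; first by exists p.
exists (rev (belast x p)); have e : v :: rev (belast x p) = rev (x :: p).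
  by rewrite [in RHS]lastI rev_rcons lv.
by rewrite e is_walk_rev walk_edges_rev perm_rev.
Qed.

Lemma merge_walks v w1 w2 : is_walk w1 -> is_walk w2 -> 0 < ends v w1 -> 0 < ends v w2 ->
  exists w, is_walk w /\ perm_eq (walk_edges w) (walk_edges w1 ++ walk_edges w2).
Proof.
move=> /walk_from h1 /walk_from h2 /h1[q1 [w1' p1]] /h2[q2 [w2' p2]].
exists (rev q1 ++ v :: q2); split.
  have : is_walk (rcons (rev q1) v) by rewrite -rev_cons is_walk_rev.
  case: (rev q1) => //= y s; rewrite rcons_path cat_path /= => /andP[-> ->].
  exact: w2'.
rewrite walk_edges_cat -rev_cons walk_edges_rev perm_cat //.
by rewrite perm_sym perm_rev perm_sym // in p1 *; rewrite perm_rev.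
Qed.

Lemma ends_le2 v w : ends v w <= 2.
Proof. by case: w => //= x p; case: eqP; case: eqP. Qed.

Lemma perm_all_edges W W' : perm_eq W W' -> perm_eq (all_edges W) (all_edges W').
Proof. by move=> WW'; apply/perm_flatten/perm_map. Qed.

(** A vertex that occurs more than twice as an end is an end of two different
    walks.  These can be joined there, which lowers the number of walks. *)
Lemma trail_decomposition W : all is_walk W ->
  exists W', [/\ all is_walk W', perm_eq (all_edges W') (all_edges W)
    & forall v, \sum_(w <- W') ends v w <= 2].
Proof.
have [n] := ubnP (size W); elim: n W => // n IHn W ltW wW.
have [/forallP W2|/forallPn[v]] := boolP [forall v : G, \sum_(w <- W) ends v w <= 2].
  by exists W.
rewrite -ltnNge => W3.
have has_end (W' : seq (seq G)) : 0 < \sum_(w <- W') ends v w -> exists2 w, w \in W' & 0 < ends v w.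
  move=> W'0; suff /hasP[w] : has (fun w => 0 < ends v w) W' by exists w.
  apply: contraLR W'0 => /hasPn nW'; rewrite -leqNgt leqn0 big_seq big1 // => w /nW'.
  by rewrite lt0n negbK => /eqP.
have [w1 w1W w1v] := has_end W (ltnW (ltnW W3)).
have pW := perm_to_rem w1W.
have [|w2 w2W w2v] := has_end (rem w1 W).
  by move: W3; rewrite (perm_big _ pW) big_cons /=; have := ends_le2 v w1; lia.
have pW' := perm_to_rem w2W; set W2 := rem w2 _ in pW'.
have pWW : perm_eq W [:: w1, w2 & W2].
  by rewrite (permPl pW) perm_cons.
have /and3P[walk1 walk2 walkW2] : all is_walk [:: w1, w2 & W2] by rewrite -(perm_all _ pWW).
have [w [walk_w pw]] := merge_walks walk1 walk2 w1v w2v.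
have [||W' [wW' pW'' W'2]] := IHn (w :: W2).
- by move: ltW; rewrite (perm_size pWW).
- by rewrite /= walk_w.
exists W'; split=> //; rewrite (permPl pW'') perm_sym.
rewrite (permPl (perm_all_edges pWW)) /all_edges /= catA perm_cat2r.
by rewrite perm_sym.
Qed.

Lemma edge_trails (E : {set {set G}}) : E \subset edges G ->
  exists W, [/\ all is_walk W, perm_eq (all_edges W) (enum E)
    & forall v, \sum_(w <- W) ends v w <= 2].
Proof.
move=> EG.
have [W [wW eW]] : exists W, all is_walk W /\ all_edges W = enum E.
  have : {subset enum E <= edges G} by move=> e; rewrite mem_enum => /(subsetP EG).
  elim: (enum E) => [|e s IHs] sE; first by exists [::].
  have [|W [wW eW]] := IHs; first by move=> e' e's; apply: sE; rewrite inE e's orbT.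
  have /edgesP[x [y [xy ->]]] := sE e (mem_head _ _).
  by exists ([:: x; y] :: W); rewrite /= xy /= /all_edges /= -eW.
by have [W' [wW' pW' W'2]] := trail_decomposition wW; exists W'; rewrite -eW.
Qed.
End Walks.

(** * Packing short closed trails *)

Lemma eq_set2 (T : finType) (a b c d : T) :
  ([set a; b] == [set c; d]) = (a == c) && (b == d) || (a == d) && (b == c).
Proof.
apply/eqP/idP => [e|/orP[]/andP[/eqP-> /eqP->] //]; last exact: setUC.
have := set21 a b; have := set22 a b; have := set21 c d; have := set22 c d.
rewrite e -{1 2}e !inE ![c == _]eq_sym ![d == _]eq_sym.
by case: (a == c); case: (a == d); case: (b == c); case: (b == d).
Qed.

Section Gadgets.
Variable G : sgraph.
Implicit Types (v x y u : G) (w p q : seq G) (S Z : {set G}) (F : seq {set G}).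

(** A closed trail from v to v through all edges of a copy of K_{2,4}, with v
    and h on the side of size two.  In a dense graph such an h, having four
    common neighbours with v, is found by double counting. *)
Definition gadget v (g : seq G) : Prop :=
  exists h x1 x2 x3 x4, uniq [:: v; h; x1; x2; x3; x4]
    /\ g = [:: v; x1; h; x2; v; x3; h; x4; v].

Lemma gadget_edges_uniq v g : gadget v g -> uniq (walk_edges g).
Proof.
move=> [h [x1 [x2 [x3 [x4 [+ ->]]]]]].
case/and5P; rewrite !inE !negb_or => /and5P[vh v1 v2 v3 v4] /and4P[h1 h2 h3 h4].
move=> /and3P[n12 n13 n14] /andP[n23 n24] /andP[n34 _].
have neq := (negPf vh, negPf v1, negPf v2, negPf v3, negPf v4, negPf h1,
  negPf h2, negPf h3, negPf h4, negPf n12, negPf n13, negPf n14, negPf n23,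
  negPf n24, negPf n34, eq_sym h v, eq_sym x1 v, eq_sym x2 v, eq_sym x3 v,
  eq_sym x4 v, eq_sym x1 h, eq_sym x2 h, eq_sym x3 h, eq_sym x4 h,
  eq_sym x2 x1, eq_sym x3 x1, eq_sym x4 x1, eq_sym x3 x2, eq_sym x4 x2, eq_sym x4 x3).
by rewrite /= !inE !eq_set2 !neq !andbF.
Qed.

Definition load F u := count (fun e : {set G} => u \in e) F.

Definition free_nbhd F Z y : {set G} :=
  [set x in neighbors y | ([set y; x] \notin F) && (x \notin Z)].

Lemma card_free_nbhd F Z y : #|neighbors y| <= #|free_nbhd F Z y| + load F y + #|Z|.
Proof.
pose B := [set x in neighbors y | [set y; x] \in F].
have sub : neighbors y \subset free_nbhd F Z y :|: B :|: Z.
  apply/subsetP => x yx; rewrite in_setU in_setU [x \in B]inE [x \in free_nbhd _ _ _]inE yx /=.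
  by case: (_ \in F) => //=; case: (x \in Z).
apply: leq_trans (subset_leq_card sub) _.
apply: leq_trans (leq_card_setU _ _) _; rewrite leq_add2r.
apply: leq_trans (leq_card_setU _ _) _; rewrite leq_add2l.
rewrite -(card_in_imset (f := fun x => [set y; x]) (D := mem B)); last first.
  move=> x x' /setIdP[yx _] _ /setP/(_ x); rewrite !inE eqxx orbT.
  have /negPf-> : x != y by rewrite eq_sym adj_neq //; rewrite inE in yx.
  by move=> /esym/eqP.
rewrite /load -size_filter; apply: leq_trans (card_size _).
apply/subset_leq_card/subsetP => _ /imsetP[x /setIdP[_ xF] ->].
by rewrite mem_filter set21.
Qed.

Lemma sum_load F : {subset F <= edges G} -> \sum_u load F u = 2 * size F.
Proof.
elim: F => [|e F IHF] FE; first by rewrite big1.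
rewrite /load /= big_split /= IHF; last by move=> f fF; apply: FE; rewrite inE fF orbT.
have e2 : \sum_(u : G) (u \in e) = 2.
  rewrite -(card_edge (FE e (mem_head _ _))) -sum1_card [RHS]big_mkcond /=.
  by apply: eq_bigr => u _; case: (u \in e).
by rewrite e2 mulnS.
Qed.

(** The neighbourhoods of the d/2 free neighbours of v have total size at
    least d^2/4, which exceeds 3|G|; so some vertex h belongs to four of
    them. *)
Lemma free_gadget F Z v d : v \in Z ->
    d <= 2 * #|free_nbhd F Z v| ->
    (forall x, x \notin Z -> d <= 2 * #|free_nbhd F Z x|) ->
    12 * #|G| < d ^ 2 ->
  exists g, [/\ gadget v g, is_walk g, all [predC mem F] (walk_edges g)
    & forall u, u \in g -> u != v -> u \notin Z].
Proof.
move=> vZ dv dx lt_d.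
pose S h := [set x in free_nbhd F Z v | h \in free_nbhd F Z x].
have [h] : exists h, 3 < #|S h|.
  apply/existsP; apply: contraLR lt_d => /existsPn S3; rewrite -leqNgt.
  have : \sum_h #|S h| <= 3 * #|G|.
    rewrite mulnC -sum_nat_const; apply: leq_sum => h _; by rewrite leqNgt.
  have -> : \sum_h #|S h| = \sum_(x in free_nbhd F Z v) #|free_nbhd F Z x|.
    rewrite (eq_bigr (fun h => \sum_(x in free_nbhd F Z v) (h \in free_nbhd F Z x))); last first.
      move=> h _; rewrite -sum1_card big_mkcond [RHS]big_mkcond; apply: eq_bigr => x _.
      by rewrite [x \in S h]inE; case: (x \in _) => //=; case: (h \in _).
    rewrite exchange_big; apply: eq_bigr => x _; rewrite -sum1_card [RHS]big_mkcond.
    by apply: eq_bigr => h _; case: (h \in _).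
  have : d * #|free_nbhd F Z v| <= 2 * \sum_(x in free_nbhd F Z v) #|free_nbhd F Z x|.
    rewrite mulnC -sum_nat_const big_distrr /=; apply: leq_sum => x.
    by rewrite inE => /and3P[_ _ xZ]; apply: dx.
  move: dv; move: (\sum_(x in _) _) #|free_nbhd F Z v| #|G| => s k n; nia.
rewrite cardE; have := enum_uniq (S h); have : {subset enum (S h) <= S h}.
  by move=> x; rewrite mem_enum.
case: (enum (S h)) => [|x1 [|x2 [|x3 [|x4 s]]]] //= sub /and5P[n1 n2 n3 n4 _] _.
have S1 : x1 \in S h by apply: sub; rewrite !inE eqxx.
have S2 : x2 \in S h by apply: sub; rewrite !inE eqxx ?orbT.
have S3 : x3 \in S h by apply: sub; rewrite !inE eqxx ?orbT.
have S4 : x4 \in S h by apply: sub; rewrite !inE eqxx ?orbT.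
have SP x : x \in S h -> [/\ adj v x, adj x h, [set v; x] \notin F, [set x; h] \notin F & x \notin Z].
  move=> /setIdP[]; rewrite !inE => /and3P[-> -> ->] /and3P[-> -> _]; by split.
have hZ : h \notin Z by move: S1 => /setIdP[_]; rewrite inE => /and3P[].
have [vx1 xh1 F1 H1 Z1] := SP x1 S1; have [vx2 xh2 F2 H2 Z2] := SP x2 S2.
have [vx3 xh3 F3 H3 Z3] := SP x3 S3; have [vx4 xh4 F4 H4 Z4] := SP x4 S4.
exists [:: v; x1; h; x2; v; x3; h; x4; v]; split.
- exists h, x1, x2, x3, x4; split=> //.
  have vh : v != h by apply: contraTneq vZ => ->.
  have neqv x : adj v x -> (v == x) = false by move/adj_neq/negPf.
  have neqh x : adj x h -> (h == x) = false by rewrite adj_sym => /adj_neq/negPf.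
  rewrite /= !inE (negPf vh) !neqv // !neqh //=.
  by move: n1 n2 n3; rewrite !inE !negb_or => /and4P[-> -> -> _] /and3P[-> -> _] /andP[->].
- by rewrite /= vx1 xh1 vx3 xh3 (adj_sym h x2) xh2 (adj_sym x2 v) vx2
     (adj_sym h x4) xh4 (adj_sym x4 v) vx4.
- by rewrite /= F1 H1 F3 H3 ![[set h; _]]setUC H2 H4 ![[set _; v]]setUC F2 F4.
move=> u; rewrite !inE => + /negPf uv; rewrite uv /=.
by do ?[case/orP => [/eqP->//|]].
Qed.

Section Packing.
Variables (q c : nat).
Hypotheses (q_gt0 : 0 < q) (c_gt0 : 0 < c).
(* A vertex lying on B of the edges used so far is not used any more, except
   as the vertex v of its own gadgets.  The q|G| gadgets have 8 edges each, so
   there are at most 16q|G|/B such vertices, which is at most an eighth of the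
   minimum degree. *)
Let B := 128 * q * c.
Hypothesis deg_linear : #|G| <= c * min_degree G.
Hypothesis deg_large : 4 * B + 100 * q < min_degree G.

(** Pairs (v, g) of a vertex and a gadget at v: the gadgets are edge-disjoint,
    and those at the same vertex v share no other vertex.  The bound on the load
    keeps the greedy choice going. *)
Definition packing (L : seq (G * seq G)) : Prop :=
  let F := all_edges (map snd L) in
  [/\ forall vg, vg \in L -> gadget vg.1 vg.2 /\ is_walk vg.2,
      uniq F,
      forall u v, u != v -> count (fun vg => (vg.1 == v) && (u \in vg.2)) L <= 1
    & forall u, load F u <= B + 8 + 8 * count (fun vg => vg.1 == u) L].

Lemma walk_edges_sub w : is_walk w -> {subset walk_edges w <= edges G}.
Proof.
elim: w => // x [|y w] //= IHw /andP[xy yw] e; rewrite inE => /orP[/eqP->|]; first exact: adj_edge.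
exact: IHw.
Qed.

Lemma walk_edges_vertices w e u : e \in walk_edges w -> u \in e -> u \in w.
Proof.
elim: w => // a [|b p] //= IHw; rewrite inE => /orP[/eqP->|/IHw uw].
  by rewrite !inE => /orP[]->; rewrite ?orbT.
by move=> /uw ubp; rewrite in_cons ubp orbT.
Qed.

Lemma packing_step L v : packing L -> size L <= q * #|G| ->
    count (fun vg => vg.1 == v) L < q ->
  exists g, packing ((v, g) :: L).
Proof.
move=> [gL uF capL loadL] szL vq; set F := all_edges _ in uF loadL.
have FE : {subset F <= edges G}.
  move=> e /flatten_mapP[g /mapP[vg vgL ->]]; apply: walk_edges_sub.
  by have [] := gL vg vgL.
have szF : size F = 8 * size L.
  rewrite /F /all_edges; elim: L gL {uF capL loadL szL vq F FE} => //= vg L IHL gL.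
  rewrite size_cat IHL => [|vg' vgL]; last by apply: gL; rewrite inE vgL orbT.
  have [[h [x1 [x2 [x3 [x4 [_ ->]]]]]] _] := gL vg (mem_head _ _).
  by rewrite /= mulnS.
pose bad := [set u | B <= load F u].
pose U := [set u in flatten (map snd (filter (fun vg => vg.1 == v) L))].
pose Z := bad :|: U :|: [set v].
have card_bad : 8 * #|bad| <= min_degree G.
  have : B * #|bad| <= 2 * size F.
    rewrite -sum_load // mulnC -sum_nat_const [leqRHS](bigID (mem bad)) /=.
    apply: leq_trans (leq_addr _ _); apply: leq_sum => u; by rewrite inE.
  rewrite szF /B; move: deg_linear szL q_gt0 c_gt0; move: (size L) #|bad| #|G| (min_degree G).
  move=> s b n d n_cd s_qn q0 c0 le_b; rewrite -(@leq_pmul2l (q * c)) ?muln_gt0 ?q0 //.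
  have : q * n <= q * (c * d) by rewrite leq_mul2l n_cd orbT.
  by move: s_qn le_b; clear; nia.
have card_U : #|U| <= 9 * q.
  rewrite cardsE (leq_trans (card_size _)) //.
  apply: (@leq_trans (9 * size (filter (fun vg => vg.1 == v) L))); last first.
    by rewrite size_filter; move: vq; clear; lia.
  have : {subset filter (fun vg => vg.1 == v) L <= L} by move=> vg; rewrite mem_filter => /andP[].
  elim: (filter _ L) => //= vg L' IH L'L.
  have [[h [x1 [x2 [x3 [x4 [_ e]]]]]] _] := gL vg (L'L vg (mem_head _ _)).
  rewrite size_cat e /= mulnS leq_add2l IH // => vg' vgL'.
  by apply: L'L; rewrite inE vgL' orbT.
have card_Z : 8 * #|Z| <= min_degree G + 72 * q + 8.
  have := leq_of_leqif (leq_card_setU (bad :|: U) [set v]).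
  have := leq_of_leqif (leq_card_setU bad U).
  rewrite cards1 -/Z; move: card_bad card_U.
  by move: #|Z| #|bad :|: U| #|bad| #|U| (min_degree G) => z bu b u d; clear; lia.
have nbhd y : load F y <= B + 8 + 8 * q -> min_degree G <= 2 * #|free_nbhd F Z y|.
  have := min_degree_le y; have := card_free_nbhd F Z y.
  move: card_Z deg_large q_gt0.
  move: #|neighbors y| #|free_nbhd F Z y| (load F y) #|Z| (min_degree G) B => a b l z d B'.
  by clear; lia.
have [||x||g [gv wg gF gZ]] := @free_gadget F Z v (min_degree G).
- by rewrite !inE eqxx orbT.
- by apply: nbhd; apply: leq_trans (loadL v) _; rewrite leq_add2l leq_mul2l /= ltnW.
- rewrite !inE !negb_or -ltnNge => /andP[/andP[/ltnW xB _] _]; apply: nbhd.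
  by apply: leq_trans xB _; rewrite -addnA leq_addr.
- move: deg_linear deg_large q_gt0 c_gt0; rewrite /B.
  move: #|G| (min_degree G) => n d; clear; nia.
exists g; split=> /=.
- by move=> vg; rewrite inE => /orP[/eqP->|/gL].
- rewrite /all_edges /= cat_uniq uF (gadget_edges_uniq gv) andbT /=.
  by rewrite has_sym -all_predC; apply: sub_all gF.
- move=> u y uy /=.
  have [vy|] := eqVneq v y; last by rewrite add0n => _; apply: capL.
  rewrite -vy in uy *; have [ug|] := boolP (u \in g); last by rewrite add0n => _; apply: capL.
  have : u \notin U by apply: contra (gZ u ug uy) => uU; rewrite 2!in_setU uU orbT.
  move=> uU; rewrite andbT add1n ltnS leqn0.
  rewrite eqn0Ngt -has_count; apply: contra uU => /hasP[vg vgL /andP[vgv uvg]].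
  by rewrite inE; apply/flatten_mapP; exists vg => //; rewrite mem_filter vgv.
move=> u; rewrite /load /all_edges /= count_cat.
have sz8 : count (fun e : {set G} => u \in e) (walk_edges g) <= 8.
  apply: leq_trans (count_size _ _) _.
  by have [h [x1 [x2 [x3 [x4 [_ ->]]]]]] := gv.
have := loadL u; rewrite /load -/F; move: sz8; have [<-|vu] := eqVneq v u; move=> sz8.
  by rewrite add1n mulnS => le_v; rewrite addnCA leq_add.
rewrite add0n; have [ug|ug] := boolP (u \in g); last first.
  suff -> : count (fun e : {set G} => u \in e) (walk_edges g) = 0 by [].
  apply/eqP; rewrite eqn0Ngt -has_count; apply: contra ug => /hasP[e eg ue].
  exact: walk_edges_vertices eg ue.
have : u \notin Z by rewrite gZ // eq_sym.
rewrite !inE !negb_or -ltnNge => /andP[/andP[+ _] _].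
by move: sz8; rewrite /load -/F; move: (count _ _) (count _ _) (count _ _) => a b k; clear; lia.
Qed.

Lemma gadget_packing : exists L, packing L /\
  forall v, count (fun vg => vg.1 == v) L = q.
Proof.
pose ts := flatten [seq nseq q v | v <- enum G].
have ts_count v : count_mem v ts = q.
  rewrite /ts count_flatten -map_comp sumnE big_map big_enum /= (bigD1 v) //=.
  rewrite count_nseq /= eqxx mul1n big1 ?addn0 // => y /negPf yv.
  by rewrite count_nseq /= yv.
have ts_size : size ts = q * #|G|.
  rewrite size_flatten /shape -map_comp sumnE big_map big_enum /=.
  rewrite (eq_bigr (fun=> q)); last by move=> *; rewrite size_nseq.
  by rewrite sum_nat_const mulnC.
suff [L [pL mL]] : exists L, packing L /\ map fst L = ts.
  by exists L; split=> // v; rewrite -(ts_count v) -mL count_map.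
have : forall v, count_mem v ts <= q by move=> v; rewrite ts_count.
have : size ts <= q * #|G| by rewrite ts_size.
elim: ts {ts_count ts_size} => [|v ts IHts] /= sz cnt.
  by exists [::]; split.
have [||L [pL mL]] := IHts; first exact: ltnW.
  by move=> u; apply: leq_trans (cnt u); exact: leq_addl.
have [||g pg] := @packing_step L v pL.
- by rewrite -(size_map fst) mL ltnW.
- rewrite -(count_map fst (pred1 v)) mL.
  by have := cnt v; rewrite eqxx add1n.
by exists ((v, g) :: L); rewrite /= mL.
Qed.
End Packing.
End Gadgets.

(** * Alternating sequences along trails *)

Lemma greedy_alt_cat a X Y : exists a',
  greedy_alt a (X ++ Y) = greedy_alt a X + greedy_alt a' Y.
Proof.
elim: X a => [|x X IHX] a /=; first by exists a.
case: eqP => _; last exact: IHX.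
by have [a' ->] := IHX (~~ a); exists a'.
Qed.

Lemma greedy_alt_one_sign a b X : all (fun x => x != Some (~~ b)) X -> greedy_alt a X <= 1.
Proof.
move=> Xb; have no_flip : greedy_alt (~~ b) X = 0.
  by elim: X Xb => //= x X IHX /andP[/negPf-> /IHX].
have [->|] := eqVneq a (~~ b); first by rewrite no_flip.
have := greedy_alt_negb a X.
by case: a b no_flip {Xb} => -[] //= ->.
Qed.

Lemma greedy_alt_count a X : greedy_alt a X <= count isSome X.
Proof.
elim: X a => //= x X IHX a; case: eqP => [->|_]; first by rewrite ltnS.
exact: leq_trans (IHX a) (leq_addl _ _).
Qed.

Lemma greedy_alt_flatten (I : eqType) (s : seq I) (F : I -> seq sign) (gain cost : I -> nat) :
    (forall i, i \in s -> forall a, 2 * greedy_alt a (F i) + gain i <= cost i) ->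
  forall a, 2 * greedy_alt a (flatten (map F s)) + \sum_(i <- s) gain i <= \sum_(i <- s) cost i.
Proof.
elim: s => [|i s IHs] bnd a; first by rewrite !big_nil.
have [a' eqf] := greedy_alt_cat a (F i) (flatten (map F s)).
rewrite /= !big_cons eqf mulnDr addnACA leq_add ?bnd ?mem_head // IHs // => j js.
by apply: bnd; rewrite inE js orbT.
Qed.

Section Ordering.
Variable G : sgraph.
Implicit Types (v x y u : G) (e : {set G}) (w p : seq G).

Section Alternation.
Variables (chi : {set G} -> sign) (T : bool -> {set G}).

Definition weight v : nat := (v \in T true) + (v \in T false).
Definition edge_weight e : nat := \sum_(v in e) weight v.
Definition one_sided v : bool := (v \in T true) (+) (v \in T false).

(** The trails take account only of the visits to T true and T false; a signed
    edge that misses the set of its sign has to be paid for separately. *)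
Definition stray e : bool := if chi e is Some b then [disjoint e & T b] else false.

Lemma edge_weight_pair x y : x != y -> edge_weight [set x; y] = weight x + weight y.
Proof. by move=> xy; rewrite /edge_weight big_setU1 ?inE // big_set1. Qed.

(** Each edge of weight 1 pays one half of a sign change.  The correction terms
    at the first vertex x are a potential: x in T a but not in T (~~ a) may
    finance, with the next edge, a change to the awaited sign a, whereas after
    a change to a at such a vertex the sign ~~ a is awaited and the next edge
    at it repays.  A stray edge that changes the sign is charged 2 directly. *)
Lemma walk_alternation x p a : is_walk (x :: p) ->
  2 * greedy_alt a (map chi (walk_edges (x :: p))) + (x \in T (~~ a))
    <= \sum_(e <- walk_edges (x :: p)) edge_weight e + (x \in T a)
       + one_sided (last x p) + 2 * count stray (walk_edges (x :: p)).
Proof.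
elim: p x a => [|y p IHp] x a.
  rewrite /= big_nil /one_sided.
  by case: a; case: (x \in T true); case: (x \in T false).
rewrite [is_walk _]/= => /andP[xy yp].
have wt z : weight z = (z \in T a) + (z \in T (~~ a)).
  by rewrite /weight; case: a; rewrite 1?addnC.
have := IHp y (~~ a) yp; have := IHp y a yp; rewrite negbK.
set es := walk_edges (y :: p); rewrite -[walk_edges (x :: _)]/([set x; y] :: es).
rewrite -[last x _]/(last y p) [map chi (_ :: _)]/= [count _ (_ :: _)]/=.
rewrite [greedy_alt a (_ :: _)]/= big_cons edge_weight_pair ?(adj_neq xy) // !wt.
move: es (one_sided _) => es o; move: (count stray es) => k.
move: (\sum_(e <- _) _) (greedy_alt _ _) (greedy_alt _ _) => W f1 f2.
have [chi_a|_] := eqP; last first.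
  move: (nat_of_bool (x \in _)) (nat_of_bool (x \in _)) (nat_of_bool (y \in _))
    (nat_of_bool (y \in _)) (nat_of_bool o) (nat_of_bool (stray _)) => xa xb ya yb o' s.
  by clear; lia.
have : 0 < (x \in T a) + (y \in T a) + stray [set x; y].
  rewrite /stray chi_a !addn_gt0 !lt0b; apply/negPn; rewrite !negb_or.
  apply/negP => /andP[/andP[xT yT] /negP[]].
  rewrite -setI_eq0; apply/eqP/setP => z; rewrite !inE.
  by apply/negP => /andP[/orP[]/eqP->]; apply/negP.
move: (nat_of_bool (x \in _)) (nat_of_bool (x \in _)) (nat_of_bool (y \in _))
  (nat_of_bool (y \in _)) (nat_of_bool o) (nat_of_bool (stray _)) => xa xb ya yb o' s.
by clear; lia.
Qed.

Lemma sum_ends w : is_walk w ->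
  \sum_(v | one_sided v) ends v w = if w is x :: p then one_sided x + one_sided (last x p) else 0.
Proof.
have sum1 y : \sum_(v | one_sided v) (y == v) = one_sided y.
  rewrite big_mkcond (bigD1 y) //= eqxx big1 => [|v /negPf vy].
    by rewrite addn0; case: (one_sided y).
  by rewrite eq_sym vy; case: (one_sided v).
by case: w => // x p _; rewrite /ends big_split /= !sum1.
Qed.

Lemma trail_alternation w a : is_walk w ->
  2 * greedy_alt a (map chi (walk_edges w)) + 0
    <= \sum_(e <- walk_edges w) edge_weight e + \sum_(v | one_sided v) ends v w
       + 2 * count stray (walk_edges w).
Proof.
move=> ww; rewrite (sum_ends ww); case: w ww => // x p ww.
have := walk_alternation a ww.
have : (x \in T a) <= one_sided x + (x \in T (~~ a)).
  by rewrite /one_sided; case: a; case: (x \in T true); case: (x \in T false).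
move: (\sum_(e <- _) _) (greedy_alt _ _) (count _ _) (nat_of_bool (one_sided _))
  (nat_of_bool (one_sided _)) (nat_of_bool (x \in _)) (nat_of_bool (x \in _)) => W f k o1 o2 xa xb.
by clear; lia.
Qed.

Definition dirty v (g : seq G) : bool :=
  has (fun u => (u != v) && (u \in T true :|: T false)) g || has stray (walk_edges g).

(** In a clean gadget at a one-sided vertex v all signs are equal, since only
    the four edges at v can carry one, so at most one of them counts; four edges
    of weight 1 would pay for two. *)
Lemma clean_gadget_alternation v g a : gadget v g -> one_sided v -> ~~ dirty v g ->
  2 * greedy_alt a (map chi (walk_edges g)) + 2 <= \sum_(e <- walk_edges g) edge_weight e.
Proof.
move=> gad side; rewrite negb_or => /andP[/hasPn clean /hasPn nostray].
have outside u : u \in g -> u != v -> u \notin T true /\ u \notin T false.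
  by move=> ug uv; have := clean u ug; rewrite uv inE negb_or => /andP.
have [b [vb vnb]] : exists b, v \in T b /\ v \notin T (~~ b).
  by move: side; rewrite /one_sided; case E : (v \in T true); case F : (v \in T false) => // _;
     [exists true | exists false]; rewrite E F.
have le1 : greedy_alt a (map chi (walk_edges g)) <= 1.
  apply: (@greedy_alt_one_sign _ b); rewrite all_map; apply/allP => e eg /=.
  apply: contra (nostray e eg) => /eqP chi_e; rewrite /stray chi_e -setI_eq0 -subset0.
  apply/subsetP => u /setIP[ue uT]; have ug := walk_edges_vertices eg ue.
  have [uv|uv] := eqVneq u v; first by rewrite uv (negPf vnb) in uT.
  by have [] := outside u ug uv; case: (b) uT => /= ->.
have W4 : \sum_(e <- walk_edges g) edge_weight e = 4.
  have [h [x1 [x2 [x3 [x4 [un eg]]]]]] := gad.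
  have wt0 u : u \in g -> u != v -> weight u = 0.
    by move=> ug uv; have [/negPf ut /negPf uf] := outside u ug uv; rewrite /weight ut uf.
  have wt1 : weight v = 1.
    by move: side; rewrite /weight /one_sided; case: (v \in T true); case: (v \in T false).
  move: un; case/and5P; rewrite !inE !negb_or => /and5P[vh v1 v2 v3 v4] /and4P[h1 h2 h3 h4] _ _ _.
  have ng u : u \in g -> v != u -> weight u = 0 by rewrite eq_sym; exact: wt0.
  have := (ng h, ng x1, ng x2, ng x3, ng x4).
  rewrite eg !inE !eqxx !orbT => -[[[[/(_ isT vh) wh /(_ isT v1) w1] /(_ isT v2) w2]
    /(_ isT v3) w3] /(_ isT v4) w4].
  rewrite /= !big_cons big_nil !edge_weight_pair 1?eq_sym // ?wt1 ?wh ?w1 ?w2 ?w3 ?w4 //;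
    by rewrite eq_sym.
by rewrite W4; move: le1; clear; lia.
Qed.

(** The uniform form of the bound for a gadget: a dirty gadget at a one-sided
    vertex loses 2 for its two ends at v and misses the gain of 2. *)
Lemma gadget_alternation v g a : gadget v g -> is_walk g ->
  2 * greedy_alt a (map chi (walk_edges g)) + 2 * one_sided v
   <= \sum_(e <- walk_edges g) edge_weight e + 4 * (one_sided v && dirty v g)
      + 2 * count stray (walk_edges g).
Proof.
move=> gad wg; have [side|nside] /= := boolP (one_sided v); last first.
  have := trail_alternation a wg; rewrite (sum_ends wg).
  have [h [x1 [x2 [x3 [x4 [_ ->]]]]]] := gad.
  by rewrite [last _ _]/= (negPf nside) !addn0.
have [_|clean] := boolP (dirty v g); last first.
  by rewrite muln0 addn0; apply: leq_trans (clean_gadget_alternation a gad side clean) (leq_addr _ _).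
have := trail_alternation a wg; rewrite (sum_ends wg).
have [h [x1 [x2 [x3 [x4 [_ ->]]]]]] := gad.
rewrite [last _ _]/= side.
move: (\sum_(e <- _) _) (greedy_alt _ _) (count _ _) => W f k.
clear; lia.
Qed.
End Alternation.
End Ordering.

(** * Sign classes without r disjoint edges *)

Section EdgeCounting.
Variable G : sgraph.
Implicit Types (v x y u : G) (e : {set G}) (w p : seq G) (S : {set G}).

Lemma min_degree_le_card : min_degree G <= #|G|.
Proof. by rewrite /min_degree; elim/big_rec: _ => // v n _; rewrite geq_min orbC => ->. Qed.

Definition edges_inside S : {set {set G}} := [set e in edges G | e \subset S].

Lemma card_edges_inside S : #|edges_inside S| <= #|S| ^ 2.
Proof.
rewrite -mulnn -cardsX; apply: leq_trans (leq_imset_card (fun z => [set z.1; z.2]) _).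
apply/subset_leq_card/subsetP => e; rewrite inE => /andP[/edgesP[x [y [_ ->]]]].
rewrite subUset !sub1set => /andP[xS yS].
by apply/imsetP; exists (x, y); rewrite // inE xS.
Qed.

Lemma exchange_incident (E : {set {set G}}) S :
  \sum_(e in E) #|e :&: S| = \sum_(v in S) #|incident E v|.
Proof.
transitivity (\sum_(e in E) \sum_(v in S) (v \in e)).
  apply: eq_bigr => e _; rewrite -sum1_card big_mkcond [RHS]big_mkcond.
  by apply: eq_bigr => v _; rewrite inE; case: (v \in e); case: (v \in S).
rewrite exchange_big; apply: eq_bigr => v _; rewrite -sum1_card big_mkcond [RHS]big_mkcond.
by apply: eq_bigr => e _; rewrite [in RHS]inE; case: (e \in E); case: (v \in e).
Qed.

(** The degree sum over S counts the edges that meet S, those inside S twice. *)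
Lemma degree_sum_meeting S :
  \sum_(v in S) #|incident (edges G) v| <= #|meeting (edges G) S| + #|S| ^ 2.
Proof.
apply: leq_trans (leq_add (leqnn _) (card_edges_inside S)).
rewrite -exchange_incident -!sum1_card big_mkcond [X in _ <= X + _]big_mkcond.
rewrite [X in _ <= _ + X]big_mkcond -big_split; apply: leq_sum => e _ /=.
rewrite [e \in meeting _ _]inE [e \in edges_inside _]inE; case: ifP => //= eE.
have e2 := card_edge eE; rewrite -setI_eq0 -cards_eq0.
have [eS|neS] := boolP (e \subset S); first by rewrite (setIidPl eS) e2.
rewrite addn0; case: eqP => [-> //|_] /=; rewrite -ltnS -e2.
by apply: proper_card; rewrite properEneq subsetIl andbT; apply: contra neS => /eqP/setIidPl.
Qed.

Section ColourClasses.
Variables (chi : {set G} -> sign) (r : nat).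
Hypothesis r_gt0 : 0 < r.
Definition colour_class b : {set {set G}} := [set e in edges G | chi e == Some b].
Hypothesis chi_free : forall b, matching_free r (colour_class b).
Local Notation P := colour_class.
Let T b := heavy r (P b).

Let PE b : P b \subset edges G.
Proof. by apply/subsetP => e /setIdP[]. Qed.

Let card_T b : #|T b| < r.
Proof. exact: card_heavy. Qed.

Lemma count_stray E : uniq E -> E =i edges G -> count (stray chi T) E <= 8 * r ^ 2.
Proof.
move=> uE EE; pose Q b := P b :\: meeting (P b) (T b).
have -> : count (stray chi T) E = #|[set e in edges G | stray chi T e]|.
  rewrite -size_filter -(card_uniqP _) ?filter_uniq //; apply: eq_card => e.
  by rewrite mem_filter EE [RHS]inE andbC.
apply: (@leq_trans #|Q true :|: Q false|).
  apply/subset_leq_card/subsetP => e; rewrite inE => /andP[eE].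
  rewrite /stray; case chi_e : (chi e) => [b|] // dis.
  have : e \in Q b by rewrite !in_setD [e \in meeting _ _]inE !inE in eE *; rewrite eE chi_e eqxx dis.
  by rewrite in_setU; case: (b) => ->; rewrite ?orbT.
apply: leq_trans (leq_card_setU _ _) _.
have -> : 8 * r ^ 2 = 4 * r ^ 2 + 4 * r ^ 2 by rewrite -mulnDl.
by apply: leq_add; apply: card_light.
Qed.

Lemma greedy_alt_colour_classes (E : seq {set G}) a : uniq E -> E =i edges G ->
  greedy_alt a (map chi E) <= #|P true :|: P false|.
Proof.
move=> uE EE; apply: leq_trans (greedy_alt_count _ _) _.
rewrite count_map -size_filter -(card_uniqP _) ?filter_uniq //.
apply/subset_leq_card/subsetP => e; rewrite mem_filter EE => /andP[/= ce eE].
rewrite in_setU [e \in P true]inE [e \in P false]inE eE /=.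
by case: (chi e) ce => [[]|].
Qed.

(** With r - 1 common heavy vertices all signed edges meet them.  With fewer, a
    further vertex u still fits into a star of less than r vertices, and its
    degree outweighs the light edges of both classes. *)
Lemma same_heavy_bound E a : uniq E -> E =i edges G -> T true = T false ->
    r + 8 * r ^ 2 <= min_degree G ->
  greedy_alt a (map chi E) <= turan_matching G r.
Proof.
move=> uE EE TT deg; apply: leq_trans (greedy_alt_colour_classes a uE EE) _.
have [full|nfull] := eqVneq #|T true|.+1 r.
  apply: leq_trans (star_turan (card_T true)); apply/subset_leq_card/subsetP => e.
  have P_T b : P b = meeting (P b) (T true).
    have Tb : T b = T true by case: b.
    by rewrite -Tb; apply: heavy_cover; rewrite // -/(T b) Tb.
  by rewrite in_setU (P_T true) (P_T false) => /orP[]; rewrite !inE => /andP[/andP[-> _] ->].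
have {}nfull : #|T true|.+1 < r by rewrite ltn_neqAle nfull card_T.
have [u uT] : exists u, u \notin T true.
  apply/existsP; apply: contraTT (card_T true); rewrite negb_exists -leqNgt => /forallP allT.
  apply: leq_trans (leq_trans (leq_addr _ _) deg) (leq_trans min_degree_le_card _).
  apply/subset_leq_card/subsetP => z _.
  by have := allT z; rewrite negbK.
apply: leq_trans (star_turan (S := u |: T true) _); last by rewrite cardsU1 uT add1n.
pose I := incident (edges G) u :\: meeting (edges G) (T true).
have -> : meeting (edges G) (u |: T true) = meeting (edges G) (T true) :|: I.
  apply/setP => e; rewrite in_setU in_setD [LHS]inE [e \in meeting _ _]inE [e \in incident _ _]inE.
  rewrite -!setI_eq0 setIUr setU_eq0 negb_and !setI_eq0 disjoint_sym disjoints1 negbK.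
  by case: (e \in edges G) => //=; case: (u \in e); case: [disjoint _ & _].
rewrite [leqRHS]cardsU [meeting _ _ :&: _](_ : _ = set0) ?cards0 ?subn0; last first.
  by apply/setP => e; rewrite in_setI in_setD in_set0; case: (e \in meeting _ _).
have cI : #|incident (edges G) u| <= #|I| + #|T true|.
  rewrite -(cardsID (meeting (edges G) (T true)) (incident _ u)) addnC leq_add2l.
  apply: leq_trans (leq_imset_card (fun z => [set u; z]) (T true)).
  apply/subset_leq_card/subsetP => e; rewrite in_setI [e \in incident _ _]inE [e \in meeting _ _]inE.
  move=> /andP[/andP[eE ue] /andP[_]]; rewrite -setI_eq0 => /set0Pn[z /setIP[ze zT]].
  have [y _ ey] := edge_at eE ue; apply/imsetP; exists z => //.
  move: ze; rewrite ey !inE => /orP[/eqP zu|/eqP->//].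
  by rewrite -zu zT in uT.
have sub : #|P true :|: P false| <= #|meeting (edges G) (T true)| + 8 * r ^ 2.
  pose Q b := P b :\: meeting (P b) (T b).
  apply: (@leq_trans #|meeting (edges G) (T true) :|: (Q true :|: Q false)|).
    apply/subset_leq_card/subsetP => e; rewrite !in_setU !in_setD -TT.
    rewrite [e \in meeting (edges G) _]inE [e \in meeting (P true) _]inE [e \in meeting (P false) _]inE.
    have sP b : e \in P b -> e \in edges G by move/(subsetP (PE b)).
    by case/orP => eP; rewrite eP (sP _ eP) /=; case: [disjoint _ & _]; rewrite ?orbT.
  apply: leq_trans (leq_card_setU _ _) _; rewrite leq_add2l.
  apply: leq_trans (leq_card_setU _ _) _.
  have -> : 8 * r ^ 2 = 4 * r ^ 2 + 4 * r ^ 2 by rewrite -mulnDl.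
  by apply: leq_add; apply: card_light.
apply: leq_trans sub _; rewrite leq_add2l -(leq_add2r #|T true|).
apply: leq_trans cI; rewrite card_incident; apply: leq_trans (min_degree_le u).
by apply: leq_trans deg; rewrite addnC leq_add2r ltnW.
Qed.
End ColourClasses.
End EdgeCounting.

(** * The ordering *)

Lemma count_sum (I : Type) (a : pred I) (s : seq I) : count a s = \sum_(i <- s) a i.
Proof. by elim: s => [|i s IHs]; rewrite ?big_nil ?big_cons //= IHs. Qed.

Lemma sum_by_key (I : Type) (K : finType) (key : I -> K) (f : K -> bool) (a : pred I) (s : seq I) :
  \sum_(i <- s) (f (key i) && a i)
    = \sum_(k | f k) count (fun i => (key i == k) && a i) s.
Proof.
under [RHS]eq_bigr do rewrite count_sum.
rewrite exchange_big; apply: eq_bigr => i _ /=; rewrite big_mkcond (bigD1 (key i)) //= eqxx /=.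
rewrite big1 => [|k /negPf ki]; first by rewrite addn0; case: (f _).
by rewrite eq_sym ki; case: (f k).
Qed.

Section GoodOrdering.
Variable G : sgraph.
Implicit Types (v x y u : G) (e : {set G}) (w p : seq G) (S : {set G}).

Lemma sum_edge_weight (T : bool -> {set G}) E : uniq E -> E =i edges G ->
  \sum_(e <- E) edge_weight T e
    = \sum_(v in T true) #|incident (edges G) v| + \sum_(v in T false) #|incident (edges G) v|.
Proof.
move=> uE EE; rewrite big_uniq //= (eq_bigl _ _ EE) -!exchange_incident -big_split.
apply: eq_bigr => e _; rewrite /edge_weight /weight big_split -!sum1_card.
by congr (_ + _); rewrite big_mkcond [RHS]big_mkcond; apply: eq_bigr => v _;
   rewrite inE; case: (v \in e); case: (v \in T _).
Qed.

Section Bound.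
Variables (r q c : nat) (L : seq (G * seq G)) (W : seq (seq G)).
Hypothesis r_gt0 : 0 < r.
Hypothesis packL : packing q c L.
Hypothesis countL : forall v, count (fun vg => vg.1 == v) L = q.
Hypotheses (walkW : all (@is_walk G) W) (endsW : forall v, \sum_(w <- W) ends v w <= 2).
Let E := all_edges (map snd L) ++ all_edges W.
Hypotheses (uE : uniq E) (EE : E =i edges G).
Hypothesis q_large : 25 * r ^ 2 + 4 * r + 1 <= q.

Variable chi : {set G} -> sign.
Hypothesis chi_free : forall b, matching_free r (colour_class chi b).
Let T b := heavy r (colour_class chi b).

Let os := one_sided T.
Let x := count (stray chi T) E.
Let t := #|T true :|: T false|.
Let d vg := dirty chi T vg.1 vg.2.

(** Each heavy vertex lies on at most one gadget at v, and each stray edge on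
    at most one gadget. *)
Lemma dirty_count v : count (fun vg => (vg.1 == v) && d vg) L <= t + x.
Proof.
have [gadL _ capL _] := packL.
have xL : \sum_(vg <- L) count (stray chi T) (walk_edges vg.2) <= x.
  rewrite /x /E count_cat; apply: leq_trans (leq_addr _ _).
  by rewrite /all_edges count_flatten sumnE !big_map.
apply: leq_trans (leq_add (leqnn t) xL).
apply: (@leq_trans (\sum_(u in T true :|: T false)
     count (fun vg => (vg.1 == v) && ((u != v) && (u \in vg.2))) L
   + \sum_(vg <- L) count (stray chi T) (walk_edges vg.2))); last first.
  rewrite leq_add2r /t -sum1_card; apply: leq_sum => u _.
  have [->|uv] := eqVneq u v; last exact: capL.
  by rewrite (eq_count (a2 := pred0)) ?count_pred0 // => vg /=; rewrite andbF.
under eq_bigr do rewrite count_sum.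
rewrite exchange_big -big_split count_sum /=; apply: leq_sum => vg _.
case: eqP => //= <-.
rewrite /d /dirty; case: hasP => [[u ug /andP[uv uT]]|_] /=.
  apply: leq_trans (leq_addr _ _).
  by rewrite (bigD1 u) //= uv ug.
by apply: leq_trans (leq_addl _ _); rewrite has_count; case: (count _ _).
Qed.

Lemma sides_sum : \sum_(vg <- L) os vg.1 = q * #|[set v | os v]|.
Proof.
transitivity (\sum_(vg <- L) (os vg.1 && true)); first by under [RHS]eq_bigr do rewrite andbT.
rewrite (sum_by_key (fun vg => vg.1) os predT).
rewrite (eq_bigr (fun=> q)); last first.
  by move=> v _; rewrite -(countL v); apply: eq_count => vg; rewrite andbT.
by rewrite sum_nat_const mulnC; congr (_ * _); apply: eq_card => v; rewrite inE.
Qed.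

(** The sum of the bounds for all trails.  Every one-sided vertex gains 2 for
    each of its q gadgets, loses 4 for each dirty one, and 2 for the ends of the
    remaining trails. *)
Lemma alternation_total a :
  2 * greedy_alt a (map chi E) + 2 * (q * #|[set v | os v]|)
    <= \sum_(e <- E) edge_weight T e + 4 * (#|[set v | os v]| * (t + x)) + 2 * x
       + 2 * #|[set v | os v]|.
Proof.
have [gadL _ _ _] := packL; set A := [set v | os v].
have bndL := @greedy_alt_flatten _ L (fun vg => map chi (walk_edges vg.2)) _ _
  (fun vg vgL a => gadget_alternation chi T a (gadL vg vgL).1 (gadL vg vgL).2).
have bndW := @greedy_alt_flatten _ W (fun w => map chi (walk_edges w)) _ _
  (fun w wW a => trail_alternation chi T a (allP walkW w wW)).
have mapE : map chi E = flatten (map (fun vg => map chi (walk_edges vg.2)) L)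
    ++ flatten (map (fun w => map chi (walk_edges w)) W).
  by rewrite /E map_cat /all_edges !map_flatten -!map_comp.
have [a' ->] : exists a', greedy_alt a (map chi E) =
    greedy_alt a (flatten (map (fun vg => map chi (walk_edges vg.2)) L))
    + greedy_alt a' (flatten (map (fun w => map chi (walk_edges w)) W)).
  by rewrite mapE; apply: greedy_alt_cat.
have : 2 * greedy_alt a (flatten (map (fun vg => map chi (walk_edges vg.2)) L))
    + 2 * \sum_(vg <- L) os vg.1
    <= \sum_(vg <- L) \sum_(e <- walk_edges vg.2) edge_weight T e
       + 4 * \sum_(vg <- L) (os vg.1 && dirty chi T vg.1 vg.2)
       + 2 * \sum_(vg <- L) count (stray chi T) (walk_edges vg.2).
  by rewrite !big_distrr -!big_split; apply: bndL.
have : 2 * greedy_alt a' (flatten (map (fun w => map chi (walk_edges w)) W))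
    <= \sum_(w <- W) \sum_(e <- walk_edges w) edge_weight T e
       + \sum_(w <- W) \sum_(v | os v) ends v w
       + 2 * \sum_(w <- W) count (stray chi T) (walk_edges w).
  by rewrite big_distrr -!big_split; have := bndW a'; rewrite big1_eq addn0.
rewrite sides_sum -/A.
have -> : \sum_(vg <- L) (os vg.1 && dirty chi T vg.1 vg.2)
    = \sum_(v | os v) count (fun vg => (vg.1 == v) && d vg) L.
  exact: (sum_by_key (fun vg => vg.1) os d).
have le_dirty : \sum_(v | os v) count (fun vg => (vg.1 == v) && d vg) L <= #|A| * (t + x).
  rewrite -sum_nat_const; rewrite [leqRHS](eq_bigl os); last by move=> v; rewrite inE.
  by apply: leq_sum => v _; apply: dirty_count.
have le_ends : \sum_(w <- W) \sum_(v | os v) ends v w <= 2 * #|A|.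
  rewrite exchange_big mulnC -sum_nat_const [leqRHS](eq_bigl os); last by move=> v; rewrite inE.
  by apply: leq_sum => v _; apply: endsW.
have x_split : x = \sum_(vg <- L) count (stray chi T) (walk_edges vg.2)
    + \sum_(w <- W) count (stray chi T) (walk_edges w).
  by rewrite /x /E count_cat /all_edges !count_flatten !sumnE !big_map.
have -> : \sum_(e <- E) edge_weight T e
   = \sum_(vg <- L) \sum_(e <- walk_edges vg.2) edge_weight T e
     + \sum_(w <- W) \sum_(e <- walk_edges w) edge_weight T e.
  by rewrite /E big_cat /= /all_edges !big_flatten !big_map.
move: le_dirty le_ends x_split.
move: (\sum_(v | os v) _) (\sum_(w <- W) \sum_(v | os v) _) (#|A| * (t + x)) #|A| => D Y Z A'.
move: (\sum_(vg <- L) \sum_(e <- _) _) (\sum_(w <- W) \sum_(e <- _) _) => W1 W2.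
move: (\sum_(vg <- L) _) (\sum_(w <- W) _) (greedy_alt _ _) (greedy_alt _ _) x (q * A') => x1 x2 g1 g2 x' Q.
clear; lia.
Qed.

(** Some vertex is one-sided, and the gain from its q gadgets exceeds all the
    losses, which are bounded in terms of r by t <= 2r and x <= 8r^2, together
    with the edges inside T true and inside T false that the degree sums count
    twice. *)
Lemma different_heavy_bound a : T true != T false ->
  greedy_alt a (map chi E) <= turan_matching G r.
Proof.
move=> TT; have tot := alternation_total a.
have A_gt0 : 0 < #|[set v | os v]|.
  rewrite card_gt0; apply: contra TT => /eqP/setP A0; apply/eqP/setP => v.
  by have := A0 v; rewrite in_set in_set0 /os /one_sided; case: (v \in T true); case: (v \in T false).
have xr : x <= 8 * r ^ 2 by apply: count_stray.
have cT b : #|T b| < r by apply: card_heavy => //; apply/subsetP => e /setIdP[].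
have tr : t <= 2 * r.
  rewrite mul2n -addnn; apply: leq_trans (leq_card_setU _ _) _.
  by rewrite leq_add // ltnW.
have deg b : \sum_(v in T b) #|incident (edges G) v| <= turan_matching G r + r ^ 2.
  apply: leq_trans (degree_sum_meeting _) _; apply: leq_add; first exact: star_turan.
  by rewrite leq_exp2r // ltnW.
move: tot; rewrite (sum_edge_weight T uE EE).
have := leq_add (deg true) (deg false); move: A_gt0 xr tr q_large.
move: (\sum_(v in T true) _) (\sum_(v in T false) _) #|[set v | os v]| => s1 s2 A.
move: r q (r ^ 2) x t (greedy_alt _ _) (turan_matching _ _) => r' q' rr x' t' g ex.
clear; nia.
Qed.
End Bound.

(** The gadgets come first; the trails through the other edges may follow in
    any order. *)
Lemma good_ordering r c : 0 < r -> 0 < c -> #|G| <= c * min_degree G ->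
    612 * (c + 1) * (25 * r ^ 2 + 4 * r + 1) < min_degree G ->
  exists E : seq {set G}, [/\ uniq E, E =i edges G & forall chi : {set G} -> sign,
    (forall b, matching_free r (colour_class chi b)) ->
    forall a, greedy_alt a (map chi E) <= turan_matching G r].
Proof.
move=> r0 c0 n_cd deg.
(* 2q = 4(t + x) + 2x + 2 + 2r^2 for t = 2r and x = 8r^2, which is what one
   one-sided vertex has to gain. *)
set q := 25 * r ^ 2 + 4 * r + 1 in deg.
have q0 : 0 < q by rewrite /q addn1.
have degq : 4 * (128 * q * c) + 100 * q < min_degree G.
  apply: leq_ltn_trans deg; move: q q0 c0; clear; nia.
have [L [packL countL]] := gadget_packing q0 c0 n_cd degq.
set F := all_edges (map snd L).
have [gadL uF _ _] := packL.
have FE : {subset F <= edges G}.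
  by move=> e /flatten_mapP[g /mapP[vg /gadL[_ wg] ->]]; apply: walk_edges_sub.
have [W [wW pW endsW]] := @edge_trails G (edges G :\: [set e in F]) (subsetDl _ _).
have inW e : (e \in all_edges W) = (e \in edges G) && (e \notin F).
  by rewrite (perm_mem pW) mem_enum in_setD inE andbC.
have uE : uniq (F ++ all_edges W).
  rewrite cat_uniq uF (perm_uniq pW) enum_uniq andbT /=.
  by apply/hasPn => e; rewrite inW => /andP[].
have EE : F ++ all_edges W =i edges G.
  move=> e; rewrite mem_cat inW; have [/FE->|] := boolP (e \in F); first by [].
  by rewrite andbT.
exists (F ++ all_edges W); split=> // chi chi_free a.
have [TT|TT] := eqVneq (heavy r (colour_class chi true)) (heavy r (colour_class chi false)).
  apply: (same_heavy_bound r0) => //.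
  apply: leq_trans (ltnW deg); rewrite /q; move: c0; clear; nia.
exact: (different_heavy_bound r0 packL countL).
Qed.
End GoodOrdering.

(** * The chromatic and altermatic numbers of the matching graph *)

Lemma colorable_labels (F : sgraph) (K : finType) (A : {set K}) (g : F -> K) :
    (forall x, g x \in A) -> (forall x y, adj x y -> g x != g y) ->
  colorable F #|A|.
Proof.
move=> gA g_proper; apply/existsP; exists [ffun x => enum_rank_in (gA x) (g x)].
apply/forallP => x; apply/forallP => y; apply/implyP => /g_proper; rewrite !ffunE.
by apply: contraNneq => /(congr1 enum_val); rewrite !enum_rankK_in // => ->.
Qed.

Section MatchingGraph.
Variables (G : sgraph) (r : nat).
Hypothesis r_gt0 : 0 < r.

Lemma turan_attained : exists E0 : {set {set G}},
  [/\ E0 \subset edges G, matching_free r E0 & turan_matching G r = #|E0|].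
Proof.
pose p := fun E : {set {set G}} =>
  (E \subset edges G) && [forall M in matchings G r, ~~ (M \subset E)].
have p0 : p set0.
  rewrite /p sub0set; apply/forall_inP => M; rewrite inE => /and3P[_ cM _].
  by rewrite subset0 -cards_eq0 (eqP cM) -lt0n.
have p_gt0 : 0 < #|[pred E | p E]| by apply/card_gt0P; exists set0.
have [E0 /andP[E0E /forall_inP E0free] eqE] := eq_bigmax_cond (fun E : {set {set G}} => #|E|) p_gt0.
by exists E0; split=> //; rewrite -eqE.
Qed.

Lemma chromatic_matching_graph_le :
  chromatic_number (matching_graph G r) <= #|edges G| - turan_matching G r.
Proof.
have [E0 [E0E E0free ->]] := turan_attained.
have -> : #|edges G| - #|E0| = #|edges G :\: E0| by rewrite cardsD (setIidPr E0E).
apply: chromatic_number_min.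
pose g (M : matching_graph G r) := odflt set0 [pick e in val M :\: E0].
have gP M : g M \in val M /\ g M \in edges G :\: E0.
  have : val M :\: E0 != set0 by rewrite setD_eq0; apply: E0free; exact: valP M.
  rewrite /g; case: pickP => [e /setDP[eM eE0] _|none /set0Pn[e]]; last by rewrite none.
  split=> //; rewrite inE eE0; have := valP M; rewrite inE => /and3P[ME _ _].
  exact: (subsetP ME).
apply: (@colorable_labels _ _ _ g) => [M|M N /andP[_ dMN]]; first by have [] := gP M.
have [gM _] := gP M; have [gN _] := gP N.
by apply: contraTneq gN => <-; rewrite (disjointFr dMN gM).
Qed.

Section OrderedMatchings.
Variable E : seq {set G}.
Hypotheses (uE : uniq E) (EE : E =i edges G).
Hypothesis orderingE : forall chi : {set G} -> sign,
  (forall b, matching_free r (colour_class chi b)) ->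
  forall a, greedy_alt a (map chi E) <= turan_matching G r.

Let m := size E.
Let f (i : 'I_m) : {set G} := nth set0 E i.

Let f_inj : injective f.
Proof. by move=> i j /eqP; rewrite nth_uniq // => /eqP/val_inj. Qed.

Let f_onto e : e \in edges G -> exists i, e = f i.
Proof.
rewrite -EE => eE; have lt_e : index e E < m by rewrite index_mem.
by exists (Ordinal lt_e); rewrite /f nth_index.
Qed.

(** The vertices are the positions in the list E, so that the ordering of
    the hypergraph is the natural one. *)
Definition index_matchings : {set {set 'I_m}} := [set A : {set 'I_m} | f @: A \in matchings G r].

Lemma index_matchings_neq0 : set0 \notin index_matchings.
Proof. by rewrite inE imset0 inE cards0 (ltn_eqF r_gt0) andbF. Qed.

Definition ordered_matchings : hypergraph := Hypergraph index_matchings_neq0.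

Let imset_preimset (M : {set {set G}}) : M \subset edges G -> f @: (f @^-1: M) = M.
Proof.
move=> ME; apply/setP => e; apply/imsetP/idP => [[i]|eM]; first by rewrite inE => ? ->.
by have [i ei] := f_onto (subsetP ME e eM); exists i => //; rewrite inE -ei.
Qed.

Lemma ordered_matchings_hom_equiv :
  hom_equiv (kneser (hedges ordered_matchings)) (matching_graph G r).
Proof.
split.
  have fA (A : kneser index_matchings) : f @: val A \in matchings G r.
    by have := valP A; rewrite inE.
  exists (fun A : kneser index_matchings => Sub (f @: val A) (fA A) : matching_graph G r).
  move=> A B /andP[neAB dAB]; apply/andP; split.
    by apply: contraNneq neAB => /(congr1 val)/= /(imset_inj f_inj)/val_inj->.
  by rewrite /= imset_disjoint //; move=> i j _ _; apply: f_inj.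
have fM (M : matching_graph G r) : f @^-1: val M \in index_matchings.
  rewrite inE imset_preimset; first exact: valP M.
  by have := valP M; rewrite inE => /and3P[].
exists (fun M : matching_graph G r => Sub (f @^-1: val M) (fM M) : kneser index_matchings).
move=> M N /andP[neMN dMN]; apply/andP; split.
  apply: contraNneq neMN => /(congr1 val)/= /(congr1 (fun A : {set 'I_m} => f @: A)).
  have sub_edges (A : matching_graph G r) : val A \subset edges G.
    by have := valP A; rewrite inE => /and3P[].
  by rewrite !imset_preimset ?sub_edges // => /val_inj->.
by rewrite /= -setI_eq0 -preimsetI (disjoint_setI0 dMN) preimset0.
Qed.

Lemma alt_ordered_matchings : alt_number ordered_matchings <= turan_matching G r.
Proof.
have card_m : #|'I_m| = m := card_ord m.
apply: (@leq_trans (alt_ordering (H := ordered_matchings) (enum_tuple 'I_m))).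
  rewrite /alt_number.
  have : enum_tuple 'I_m \in index_enum {: #|'I_m|.-tuple 'I_m} by rewrite mem_index_enum.
  elim: (index_enum _) => //= s ss IHss; rewrite inE big_cons.
  case/orP => [/eqP <-|/IHss le]; first by rewrite /= enum_uniq geq_minl.
  by case: ifP => _ //; rewrite geq_min le orbT.
apply/bigmax_leqP => X /forall_inP Xfree.
rewrite alt_length_greedy /max_alt.
pose chi e := nth None X (index e E).
have mapX : map chi E = X.
  apply: (@eq_from_nth _ None); first by rewrite size_map size_tuple card_m.
  by move=> i; rewrite size_map => im; rewrite (nth_map set0) // /chi index_uniq.
have chi_free b : matching_free r (colour_class chi b).
  move=> M MM; apply/negP => MP.
  have ME : M \subset edges G by move: MM; rewrite inE => /and3P[].
  have AH : f @^-1: M \in index_matchings by rewrite inE imset_preimset.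
  have /forallP/(_ b)/negP := Xfree _ AH; apply; apply/subsetP => i; rewrite inE => fiM.
  have := subsetP MP _ fiM; rewrite inE /chi index_uniq // => /andP[_ /eqP chi_i].
  pose j : 'I_#|'I_m| := cast_ord (esym card_m) i.
  apply/imsetP; exists j; first by rewrite inE (tnth_nth None) /= chi_i.
  by rewrite (tnth_nth i) /= nth_ord_enum.
by rewrite -mapX geq_max !orderingE.
Qed.
End OrderedMatchings.
End MatchingGraph.

Lemma hom_equiv_chromatic (F1 F2 : sgraph) :
  hom_equiv F1 F2 -> chromatic_number F1 = chromatic_number F2.
Proof.
move=> [[h hom_h] [k hom_k]]; apply/eqP.
by rewrite eqn_leq (chromatic_number_hom hom_h) (chromatic_number_hom hom_k).
Qed.

Theorem matching_graph_dense (G : sgraph) r c : 0 < r -> 0 < c -> #|G| <= c * min_degree G ->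
    612 * (c + 1) * (25 * r ^ 2 + 4 * r + 1) < min_degree G ->
  chromatic_number (matching_graph G r) = #|edges G| - turan_matching G r /\
  is_altermatic_number (matching_graph G r) (#|edges G| - turan_matching G r).
Proof.
move=> r0 c0 n_cd deg; have [E [uE EE orderE]] := good_ordering r0 c0 n_cd deg.
have hE := ordered_matchings_hom_equiv r0 uE EE.
have lower := alt_number_chromatic (ordered_matchings r0 E).
rewrite (hom_equiv_chromatic hE) /= card_ord -(card_uniqP uE) (eq_card EE) in lower.
have altE := alt_ordered_matchings r0 uE EE orderE.
have upper := chromatic_matching_graph_le G r0.
have chiE : chromatic_number (matching_graph G r) = #|edges G| - turan_matching G r.
  apply/eqP; rewrite eqn_leq upper leq_subLR; apply: leq_trans lower _.
  by rewrite leq_add2r.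
have bound (H : hypergraph) : hom_equiv (kneser (hedges H)) (matching_graph G r) ->
    #|hvertex H| - alt_number H <= #|edges G| - turan_matching G r.
  by move=> /hom_equiv_chromatic eq_chi; rewrite -chiE -eq_chi leq_subLR alt_number_chromatic.
split=> //; split=> //; exists (ordered_matchings r0 E); split=> //.
apply/eqP; rewrite eqn_leq bound //= card_ord -(card_uniqP uE) (eq_card EE).
exact: leq_sub2l.
Qed.

Local Open Scope ring_scope.

Theorem theorem2 (R : realType) :
  exists f : R -> R,
    (forall x : R, 0 < x < 1 -> 0 < f x < 1) /\
    (forall x y : R, 0 < x < 1 -> 0 < y < 1 -> x < y -> f x < f y) /\
    (forall nu tau eta : R,
       0 < nu -> nu <= tau -> tau <= f eta -> 0 < eta < 1 ->
     forall r : nat, (0 < r)%N ->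
     exists n0 : nat, forall n : nat, (n0 <= n)%N ->
     forall G : sgraph, #|G| = n ->
       robust_expander nu tau G ->
       eta * n%:R <= (min_degree G)%:R ->
       chromatic_number (matching_graph G r) =
         (#|edges G| - turan_matching G r)%N /\
       is_altermatic_number (matching_graph G r)
         (#|edges G| - turan_matching G r)%N).
Proof.
exists id; split=> //; split=> // nu tau eta _ _ _ /andP[eta0 _] r r0.
pose c := Num.bound eta^-1.
have lt_c : eta^-1 < c%:R by apply: archi_boundP; rewrite invr_ge0 ltW.
have c0 : (0 < c)%N by rewrite -(ltr_nat R); apply: lt_trans lt_c; rewrite invr_gt0.
pose D := (612 * (c + 1) * (25 * r ^ 2 + 4 * r + 1))%N.
exists (Num.bound (eta^-1 * D%:R)) => n n_large G cardG _ deg.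
apply: (matching_graph_dense r0 c0).
  rewrite cardG -(ler_nat R) natrM.
  apply: le_trans (_ : eta^-1 * (min_degree G)%:R <= _).
    by rewrite mulrC ler_pdivlMr // mulrC.
  by rewrite ler_wpM2r // ltW.
rewrite -(ltr_nat R) -/D; apply: lt_le_trans deg.
rewrite mulrC -ltr_pdivrMr // mulrC; apply: lt_le_trans (_ : (Num.bound (eta^-1 * D%:R))%:R <= _).
  by apply: archi_boundP; rewrite mulr_ge0 // invr_ge0 ltW.
by rewrite ler_nat.
Qed.
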